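(* There exist constants $\varepsilon_0>0$, $C>0$ and $\gamma>0$, depending only on $N,\Lambda,\alpha,\beta$, such that the following holds. Let $R>0$, $\rho\ge 0$, $0<\varepsilon<\varepsilon_0R$, and let $u:\mathbb{R}^N\to\mathbb{R}$ be a bounded Borel measurable function satisfying $\mathcal{L}_\varepsilon^+u\ge-\rho$ and $\mathcal{L}_\varepsilon^-u\le\rho$ in $B_R$. Then $$|u(x)-u(z)|\le\frac{C}{R^\gamma}\Big(\sup_{B_R}|u|+R^2\rho\Big)\Big(|x-z|^\gamma+\varepsilon^\gamma\Big)$$ for every $x,z\in B_{R/2}$.
   Context: Fix the dimension $N\ge 1$, a real number $\Lambda\geq 1$, $\beta\in(0,1]$ and $\alpha=1-\beta$. $B_r(x)$ is the open Euclidean ball of radius $r$ centred at $x$ in $\mathbb{R}^N$ and $B_r=B_r(0)$. For a bounded Borel measurable function $u:\mathbb{R}^N\to\mathbb{R}$ put $\delta u(x,y)=u(x+y)+u(x-y)-2u(x)$, and for $\varepsilon>0$ define $$\mathcal{L}_\varepsilon^+u(x)=\frac{1}{2\varepsilon^2}\Big(\alpha\sup_{z\in B_\Lambda}\delta u(x,\varepsilon z)+\frac{\beta}{|B_1|}\int_{B_1}\delta u(x,\varepsilon y)\,dy\Big),$$ $$\mathcal{L}_\varepsilon^-u(x)=\frac{1}{2\varepsilon^2}\Big(\alpha\inf_{z\in B_\Lambda}\delta u(x,\varepsilon z)+\frac{\beta}{|B_1|}\int_{B_1}\delta u(x,\varepsilon y)\,dy\Big).$$ *)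

(* Defs.v *)
From HB Require Import structures.
From mathcomp Require Import all_boot all_order all_algebra.
From mathcomp Require Import all_classical all_reals all_analysis.

Set Implicit Arguments.
Unset Strict Implicit.
Unset Printing Implicit Defensive.

Import Order.TTheory GRing.Theory Num.Theory.
Import numFieldNormedType.Exports.

Local Open Scope classical_set_scope.
Local Open Scope ring_scope.

(* The library norm and [ball] on ['rV[R]_N] are those of the max norm. *)
Definition enorm (R : realType) (N : nat) (x : 'rV[R]_N) : R :=
  Num.sqrt (\sum_(i < N) x 0 i ^+ 2).

Definition eball (R : realType) (N : nat) (x : 'rV[R]_N) (r : R) :
    set 'rV[R]_N :=
  [set y | enorm (y - x) < r].

Notation borel_rV R N := (g_sigma_algebraType (@open 'rV[R]_N)).

Section image_measure.
Context d1 d2 (T1 : measurableType d1) (T2 : measurableType d2) (R : realType).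
Variables (m : {measure set T1 -> \bar R}) (f : T1 -> T2).
Hypothesis mf : measurable_fun setT f.

Definition image_measure : {measure set T2 -> \bar R} :=
  measure_function_pushforward__canonical__measure_function_Measure m mf.

Lemma image_measureE (A : set T2) : image_measure A = m (f @^-1` A).
Proof. by []. Qed.

End image_measure.

Section lebesgue_rV.
Variable R : realType.
Let RR := measurableTypeR R.

Let cons_pair (n : nat) (p : n.-tuple RR * RR) : n.+1.-tuple RR :=
  [tuple of p.2 :: p.1].

Let measurable_cons_pair (n : nat) : measurable_fun setT (@cons_pair n).
Proof. exact: measurable_cons. Qed.

(* The n-fold product measure, transported along [(t, x) |-> x :: t]. *)
Fixpoint lebesgue_tuple (n : nat) :
    {measure set (n.-tuple (measurableTypeR R)) -> \bar R} :=
  match n with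
  | 0%N => dirac [tuple]
  | n'.+1 => image_measure (lebesgue_tuple n' \x @lebesgue_measure R)%E
               (@measurable_cons_pair n')
  end.

Definition row_of_tuple (n : nat) (t : n.-tuple (measurableTypeR R)) :
    borel_rV R n :=
  \row_(i < n) tnth t i.

Let row_box (n : nat) (p : {ffun 'I_n -> rat} * nat) : set (n.-tuple RR) :=
  \bigcap_(i in setT)
    ((@tnth n RR)^~ i @^-1` (ball (ratr (p.1 i) : R) p.2.+1%:R^-1)).

Let measurable_row_box n p : measurable (@row_box n p).
Proof.
apply: fin_bigcap_measurable => // i _; rewrite -[X in measurable X]setTI.
by apply: measurable_tnth => //; exact: measurable_realfun.measurable_ball.
Qed.

Lemma measurable_row_of_tuple (n : nat) : measurable_fun setT (@row_of_tuple n).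
Proof.
apply: (@measurability _ _ _ (borel_rV R n) setT (@row_of_tuple n)
  (@open 'rV[R]_n)) => //.
move=> _ [A oA <-]; rewrite setTI.
pose P := [set p | row_box p `<=` @row_of_tuple n @^-1` A].
suff -> : @row_of_tuple n @^-1` A = \bigcup_(p in P) row_box p.
  rewrite bigcup_mkcond; apply: countable_bigcupT_measurable => // p.
  by case: ifPn => // _; exact: measurable_row_box.
apply/seteqP; split => [t At|t [p]]; last exact.
have /nbhs_ballP[e /= e0 eA] : nbhs (row_of_tuple t : 'rV[R]_n) A.
  exact: open_nbhs_nbhs.
have [k _ /(_ k (leqnn k)) /= ke] :=
  near_infty_natSinv_lt (PosNum (divr_gt0 e0 (ltr0n R 2))).
have k0 : 0 < k.+1%:R^-1 :> R by rewrite invr_gt0.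
have ht (i : 'I_n) :
    {q : rat | ball (ratr q : R) k.+1%:R^-1 (tnth t i : R)}.
  apply/cid.
  have /rat_in_itvoo[q] : (tnth t i : R) - k.+1%:R^-1 < (tnth t i : R).
    by rewrite ltrBlDr ltrDl.
  rewrite in_itv/= => /andP[q1 q2]; exists q.
  by rewrite -ball_normE/= ltr_distlC -ltrBlDr q1 andbT (lt_trans _ q2)// ltrBlDr ltrDl.
exists ([ffun i => sval (ht i)], k); last first.
  by move=> i _ /=; rewrite ffunE; exact: svalP (ht i).
move=> s sb; apply: eA; split => // i j; rewrite !mxE.
have sj := sb j I; rewrite /= ffunE in sj.
rewrite (splitr e).
apply: (@ball_triangle R R (ratr (sval (ht j)))
  (tnth t j : R) (tnth s j : R)).
  by apply/ball_sym/(le_ball (ltW ke)); exact: svalP (ht j).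
exact: (le_ball (ltW ke)) sj.
Qed.

Definition lebesgue_rV (n : nat) : {measure set (borel_rV R n) -> \bar R} :=
  image_measure (lebesgue_tuple n) (@measurable_row_of_tuple n).

End lebesgue_rV.

Definition delta2 (R : realType) (N : nat) (u : 'rV[R]_N -> R)
    (x y : 'rV[R]_N) : R :=
  u (x + y) + u (x - y) - 2 * u x.

Definition ball_average (R : realType) (N : nat) (f : 'rV[R]_N -> R) : R :=
  (\int[lebesgue_rV R N]_(y in eball 0 1) f y)
    / fine (lebesgue_rV R N (eball 0 1)).

Definition Lplus (R : realType) (N : nat) (Lambda alpha beta eps : R)
    (u : 'rV[R]_N -> R) (x : 'rV[R]_N) : R :=
  (2 * eps ^+ 2)^-1 *
    (alpha * sup [set delta2 u x (eps *: z) | z in eball 0 Lambda]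
     + beta * ball_average (fun y => delta2 u x (eps *: y))).

Definition Lminus (R : realType) (N : nat) (Lambda alpha beta eps : R)
    (u : 'rV[R]_N -> R) (x : 'rV[R]_N) : R :=
  (2 * eps ^+ 2)^-1 *
    (alpha * inf [set delta2 u x (eps *: z) | z in eball 0 Lambda]
     + beta * ball_average (fun y => delta2 u x (eps *: y))).

(* Main.v *)
Require Import Defs.
From mathcomp Require Import all_boot all_order all_algebra.
From mathcomp Require Import all_classical all_reals all_analysis.
From mathcomp Require Import measurable_realfun ring lra zify.

Set Implicit Arguments.
Unset Strict Implicit.
Unset Printing Implicit Defensive.

Import Order.TTheory GRing.Theory Num.Theory.
Import numFieldNormedType.Exports.

Local Open Scope classical_set_scope.
Local Open Scope ring_scope.

(* After rescaling to eps = 1 this is a Krylov-Safonov argument in which Savin's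
   sliding paraboloids replace the Alexandrov-Bakelman-Pucci estimate, so that
   at the discrete scale only counting is left. Suppose that a nonnegative
   supersolution is small somewhere near a cube Q of side s. Touch it from below
   by a Gaussian barrier minus paraboloids of opening ~ s^-2 with vertices on a
   grid in Q. The barrier forces the contact points into Q, where the
   supersolution is bounded by a constant M. At a contact point the average term
   bounds the mean gap over the unit ball by C s^-2; hence two contact points
   lying in the same unit cell have vertices at bounded distance, and at least a
   fixed proportion of the cells of Q contain a point where u < M. A
   Calderon-Zygmund decomposition stopped at the unit cells turns this into: if
   u >= 1 on half of the cells of Q then u >= c on Q. On a unit cell, one of
   u - inf u and sup u - u is bounded below by the average term, so one of them
   is bounded below on half of the cells; this gives the decay of the
   oscillation, and its iteration the Hoelder estimate. *)

(** * Lebesgue measure: boxes and translations *)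

(** The function is only bounded and measurable: infima need not be attained and contact sets need
    not be measurable. Contact points are therefore approximate minimizers, with an error of order
    s^-2 like every other term of the inequality at scale s, and they are counted instead of
    measured: finitely many vertices are slid, and distinct vertices yield distinct cells. For the
    same reason the equation is used only through lower bounds of second differences, and the
    average is only ever bounded by that of a step function. The term of weight alpha is an infimum
    over a ball of radius Lambda, for which nothing but a worst-case bound is available. Every gain
    has to come from the average, which is where beta > 0 enters. It is produced on a box of
    half-side 1/(16N) or on a part of one; over such a box the scalar product with a given vector
    hardly varies. Since u and -u satisfy the same one-sided inequality, only supersolutions are
    studied; the oscillation combines the two. *)

Section lebesgue_tuple_theory.
Variable R : realType.
Let RR := measurableTypeR R.

Lemma lebesgue_tupleS n (A : set (n.+1.-tuple RR)) :
  lebesgue_tuple R n.+1 A =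
  (\int[lebesgue_tuple R n]_t
     @lebesgue_measure R (fun x : RR => A [tuple of x :: t]))%E.
Proof.
transitivity (\int[lebesgue_tuple R n]_t
     @lebesgue_measure R (xsection (fun p : n.-tuple RR * RR => A [tuple of p.2 :: p.1]) t))%E; first by [].
apply: eq_integral => t _; congr (lebesgue_measure _).
apply/funext => x; apply/propext; rewrite /xsection/=; split => [|Ax].
  by rewrite inE.
by apply/mem_set.
Qed.

Lemma lebesgue_measure_translate (v : R) (A : set RR) : measurable A ->
  @lebesgue_measure R [set x : RR | A (v + x)] = @lebesgue_measure R A.
Proof.
move=> mA.
have mv : measurable_fun setT (fun x : RR => v + x : RR).
  by apply: measurable_realfun.measurable_funD => //; exact: measurable_cst.
apply/esym/(lebesgue_measure_unique (mu := image_measure (@lebesgue_measure R) mv)) => //.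
move=> _ [[a b] /= ab <-]; rewrite /pushforward/=.
rewrite [X in _ = lebesgue_measure X](_ : _ = [set` `](a - v)%R, (b - v)%R]] :> set R).
  rewrite !lebesgue_measure_itv/= !lte_fin ltrD2r; case: ifPn => // _.
  by rewrite -!EFinB opprB addrA subrK.
by apply/seteqP; split => x /=; rewrite !in_itv/= => /andP[? ?]; apply/andP; split; lra.
Qed.

Definition shift_tuple n (v : 'I_n -> R) (t : n.-tuple RR) : n.-tuple RR :=
  [tuple v i + tnth t i : RR | i < n].

Lemma measurable_shift_tuple n (v : 'I_n -> R) :
  measurable_fun setT (shift_tuple v).
Proof.
apply/measurable_fun_tnthP => i.
rewrite (_ : _ \o _ = fun t => v i + tnth t i); last first.
  by apply/funext => t /=; rewrite tnth_mktuple.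
apply: measurable_realfun.measurable_funD; first exact: measurable_cst.
exact: measurable_tnth.
Qed.

Lemma shift_tuple_cons n (v : 'I_n.+1 -> R) (x : RR) (t : n.-tuple RR) :
  shift_tuple v [tuple of x :: t] =
  [tuple of (v ord0 + x : RR) :: shift_tuple (v \o lift ord0) t].
Proof.
apply: eq_from_tnth => i; rewrite tnth_mktuple.
by case: (unliftP ord0 i) => [j|] ->; rewrite ?tnthS ?tnth0 // tnth_mktuple.
Qed.

(** Induction by slices: the inner measure is invariant in the new coordinate, and the shift of the
    remaining coordinates is carried over to the measure as a pushforward. *)
Lemma lebesgue_tuple_translate n (v : 'I_n -> R) (A : set (n.-tuple RR)) :
  measurable A -> lebesgue_tuple R n (shift_tuple v @^-1` A) = lebesgue_tuple R n A.
Proof.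
elim: n v A => [|n IH] v A mA.
  congr (lebesgue_tuple _ _ _); apply/seteqP.
  by split => t /=; rewrite (tuple0 t) (tuple0 (shift_tuple _ _)).
rewrite !lebesgue_tupleS.
pose v' := v \o lift ord0.
have mc : measurable_fun setT (fun p : n.-tuple RR * RR => [tuple of p.2 :: p.1]).
  exact: measurable_cons.
have mA' : measurable ((fun p : n.-tuple RR * RR => [tuple of p.2 :: p.1]) @^-1` A).
  by rewrite -[X in measurable X]setTI; exact: mc.
pose g (t : n.-tuple RR) := @lebesgue_measure R (fun x : RR => A [tuple of x :: t]).
have gE : g = @lebesgue_measure R \o
    xsection ((fun p : n.-tuple RR * RR => [tuple of p.2 :: p.1]) @^-1` A).
  apply/funext => t /=; congr (lebesgue_measure _).
  by apply/funext => x; apply/propext; rewrite /xsection/= inE.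
have mg : measurable_fun [set: n.-tuple RR] g.
  by rewrite gE; exact: measurable_fun_xsection.
transitivity (\int[lebesgue_tuple R n]_t (g \o shift_tuple v') t)%E.
  apply: eq_integral => t _ /=; rewrite /g.
  rewrite -[RHS](lebesgue_measure_translate (v ord0)); last first.
    rewrite [X in measurable X](_ : _ =
      xsection ((fun p : n.-tuple RR * RR => [tuple of p.2 :: p.1]) @^-1` A)
        (shift_tuple v' t)); last first.
      by apply/funext => x; apply/propext; rewrite /xsection/= inE.
    exact: measurable_xsection.
  by congr (lebesgue_measure _); apply/funext => x /=; rewrite shift_tuple_cons.
have := @ge0_integral_pushforward _ _ _ _ _ _ (measurable_shift_tuple v')
  (lebesgue_tuple R n) setT g measurableT mg (fun _ _ => measure_ge0 _ _).
rewrite preimage_setT => <-.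
apply: eq_measure_integral; first exact: measurable_shift_tuple.
by move=> mv B mB _; exact: IH.
Qed.

Lemma lebesgue_tuple_box n (c : 'I_n -> R) (r : R) : 0 < r ->
  lebesgue_tuple R n [set t | forall i, `|tnth t i - c i| < r] = ((2 * r) ^+ n)%:E.
Proof.
move=> r0; elim: n c => [|n IH] c.
  by rewrite expr0 /= diracE mem_set// => -[].
rewrite lebesgue_tupleS.
pose B := [set t : n.-tuple RR | forall i, `|tnth t i - c (lift ord0 i)| < r].
rewrite (eq_integral (fun t => (2 * r)%:E * (\1_B t)%:E)%E); last first.
  move=> t _; rewrite indicE; have [tB|tB] := boolP (t \in B).
    rewrite mule1 -(_ : lebesgue_measure (ball (c ord0 : R) r) = (2 * r)%:E); last first.
      by rewrite lebesgue_measure_ball ?(ltW r0)// mulr_natl.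
    congr (lebesgue_measure _); apply/funext => x; apply/propext.
    rewrite -ball_normE/= distrC; split => [/(_ ord0)|h i]; first by rewrite tnth0.
    case: (unliftP ord0 i) => [j|] ->; last by rewrite tnth0.
    by rewrite tnthS; move: tB; rewrite inE; apply.
  rewrite mule0 -[RHS](@measure0 _ _ _ (@lebesgue_measure R)).
  congr (lebesgue_measure _); apply/funext => x; apply/propext; split => // h.
  apply: (negP tB); apply/mem_set => i.
  by have := h (lift ord0 i); rewrite tnthS.
have mB : measurable B.
  rewrite (_ : B = \bigcap_(i in setT)
    ((@tnth n RR)^~ i @^-1` (ball (c (lift ord0 i) : R) r))); last first.
    apply/seteqP; split => t /= h i; last by have := h i I; rewrite -ball_normE/= distrC.
    by move=> _; rewrite -ball_normE/= distrC; exact: h.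
  apply: fin_bigcap_measurable => // i _; rewrite -[X in measurable X]setTI.
  by apply: measurable_tnth => //; exact: measurable_realfun.measurable_ball.
rewrite ge0_integralZl_EFin //; last 2 first.
- by apply/measurable_EFinP; exact: measurable_indic.
- by lra.
by rewrite integral_indic// setIT IH -EFinM exprS.
Qed.

End lebesgue_tuple_theory.

(** * Boxes, Euclidean balls and averages over the unit ball *)

Definition box (R : realType) (N : nat) (c : 'rV[R]_N) (r : R) : set 'rV[R]_N :=
  [set x | forall i, `|x 0 i - c 0 i| < r].

(** For [S] inside the unit ball, [t * vfrac S] is the average of the step function equal to [t] on
    [S] and to 0 elsewhere. *)
Definition vfrac (R : realType) (N : nat) (S : set 'rV[R]_N) : R :=
  fine (lebesgue_rV R N S) / fine (lebesgue_rV R N (eball 0 1)).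

Section euclid.
Context (R : realType) (N : nat).
Implicit Types (x y z : 'rV[R]_N) (r : R).

Lemma enorm_ge0 x : 0 <= enorm x.
Proof. exact: sqrtr_ge0. Qed.

Lemma enorm_lt x r : 0 < r -> (enorm x < r) = (\sum_i x 0 i ^+ 2 < r ^+ 2).
Proof.
move=> r0; rewrite /enorm -[in LHS](ger0_norm (ltW r0)) -sqrtr_sqr.
by rewrite ltr_sqrt// exprn_gt0.
Qed.

Lemma eball0_lt x r : 0 < r -> eball 0 r x <-> \sum_i x 0 i ^+ 2 < r ^+ 2.
Proof. by move=> r0; rewrite /eball/= subr0 enorm_lt. Qed.

Lemma coord_le_enorm x i : `|x 0 i| <= enorm x.
Proof.
rewrite /enorm -sqrtr_sqr ler_sqrt; last by apply: sumr_ge0 => j _; exact: sqr_ge0.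
by rewrite (bigD1 i)//= lerDl sumr_ge0// => j _; exact: sqr_ge0.
Qed.

Lemma eball0_coord x r i : eball 0 r x -> `|x 0 i| < r.
Proof. by rewrite /eball/= subr0; apply: le_lt_trans; exact: coord_le_enorm. Qed.

Lemma sumsq_le x r : (forall i, `|x 0 i| <= r) -> \sum_i x 0 i ^+ 2 <= N%:R * r ^+ 2.
Proof.
move=> h; rewrite mulr_natl -[in leRHS](card_ord N) -sumr_const.
apply: ler_sum => i _; rewrite -[leLHS]real_normK ?num_real//.
have := h i; have : 0 <= `|x 0 i| by []; nra.
Qed.

Lemma enormZ r x : enorm (r *: x) = `|r| * enorm x.
Proof.
rewrite /enorm -sqrtr_sqr -sqrtrM ?sqr_ge0//; congr Num.sqrt.
by rewrite mulr_sumr; apply: eq_bigr => i _; rewrite mxE exprMn.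
Qed.
End euclid.

Section lebesgue_rV_theory.
Context (R : realType) (N : nat).
Let V := borel_rV R N.

Lemma open_measurable_rV (A : set V) : open (A : set 'rV[R]_N) -> measurable A.
Proof. by move=> oA; exact: sub_sigma_algebra. Qed.

Lemma continuous_measurable_rV (f : 'rV[R]_N -> R) :
  continuous f -> measurable_fun [set: V] (f : V -> R).
Proof.
move=> /continuousP cf; apply: (measurability _ (RGenOpens.measurableE R)).
move=> _ [_ [a [b ->] <-]]; rewrite setTI; apply: open_measurable_rV.
exact/cf/interval_open.
Qed.

Lemma measurable_affine_rV (x : 'rV[R]_N) (e : R) :
  measurable_fun [set: V] (fun y : V => (x + e *: (y : 'rV[R]_N)) : V).
Proof.
apply: (@measurability _ _ V V setT _ (@open 'rV[R]_N)) => //.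
move=> _ [A oA <-]; rewrite setTI; apply: open_measurable_rV.
rewrite openE => y Ay.
have /nbhs_ballP[d /= d0 dA] : nbhs (x + e *: y : 'rV[R]_N) A by exact: open_nbhs_nbhs.
have e1 : 0 < `|e| + 1 by rewrite ltr_wpDl.
rewrite /interior/=; apply/nbhs_ballP; exists (d / (`|e| + 1)); first by rewrite /= divr_gt0.
move=> z [_ yz]; apply: dA; split => // i j; rewrite !mxE.
have := yz i j; rewrite -!ball_normE/= opprD addrACA subrr add0r -mulrBr normrM.
rewrite ltr_pdivlMr// mulrC => h; apply: le_lt_trans h.
by rewrite ler_wpM2r// lerDl.
Qed.

Lemma measurable_coord_rV (i : 'I_N) : measurable_fun [set: V] (fun y : V => (y : 'rV[R]_N) 0 i).
Proof. by apply: continuous_measurable_rV; exact: coord_continuous. Qed.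

Lemma measurable_eball0 r : 0 < r -> measurable (eball 0 r : set V).
Proof.
move=> r0.
have mf : measurable_fun [set: V] (fun y : V => \sum_i (y : 'rV[R]_N) 0 i ^+ 2).
  apply: measurable_sum => i; apply: measurable_funX; exact: measurable_coord_rV.
rewrite (_ : eball 0 r = (fun y : V => \sum_i (y : 'rV[R]_N) 0 i ^+ 2) @^-1` `]-oo, r ^+ 2[).
  by rewrite -[X in measurable X]setTI; exact: mf.
by apply/seteqP; split => y /=; rewrite in_itv/= (eball0_lt _ r0).
Qed.

Lemma measurable_box c r : measurable (box c r : set V).
Proof.
rewrite (_ : box c r = \bigcap_(i in setT)
    ((fun y : V => (y : 'rV[R]_N) 0 i) @^-1` (ball (c 0 i) r))); last first.
  apply/seteqP; split => t /= h i; last by have := h i I; rewrite -ball_normE/= distrC.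
  by move=> _; rewrite -ball_normE/= distrC; exact: h.
apply: fin_bigcap_measurable => // i _; rewrite -[X in measurable X]setTI.
by apply: measurable_coord_rV => //; exact: measurable_ball.
Qed.

Lemma lebesgue_rV_box c r : 0 < r -> lebesgue_rV R N (box c r) = ((2 * r) ^+ N)%:E.
Proof.
move=> r0; rewrite -(lebesgue_tuple_box (fun i => c 0 i) r0).
congr (lebesgue_tuple _ _ _); apply/seteqP.
by split => t /= h i; have := h i; rewrite mxE.
Qed.

Lemma lebesgue_rV_translate (x : 'rV[R]_N) (A : set V) : measurable A ->
  lebesgue_rV R N [set y | A (x + y)] = lebesgue_rV R N A.
Proof.
move=> mA; transitivity (lebesgue_tuple R N (@row_of_tuple R N @^-1` A)); last by [].
rewrite -[RHS](lebesgue_tuple_translate (fun i => x 0 i)); last first.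
  by rewrite -[X in measurable X]setTI; exact: measurable_row_of_tuple.
congr (lebesgue_tuple _ _ _); apply/seteqP.
suff e t : @row_of_tuple R N (shift_tuple (x 0) t) = x + row_of_tuple t.
  by split => t /=; rewrite e.
by apply/rowP => i; rewrite !mxE tnth_mktuple.
Qed.

Hypothesis N0 : (0 < N)%N.

Lemma box_sub_eball0 : @box R N 0 (2 * N%:R)^-1 `<=` eball 0 1.
Proof.
move=> y yb; apply/eball0_lt => //.
have N1 : 1 <= N%:R :> R by rewrite ler1n.
have i0 : 0 < (2 * N%:R)^-1 :> R by rewrite invr_gt0; lra.
apply: (@le_lt_trans _ _ (N%:R * (2 * N%:R)^-1 ^+ 2)).
  by apply: sumsq_le => i; have := yb i; rewrite mxE subr0 => /ltW.
have : N%:R * (2 * N%:R)^-1 = 2^-1 :> R by field; lra.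
have : (2 * N%:R)^-1 <= 2^-1 :> R by rewrite lef_pV2 ?posrE; lra.
by nra.
Qed.

Lemma eball0_sub_box : @eball R N 0 1 `<=` box 0 1.
Proof. by move=> y yb i; rewrite mxE subr0; exact: eball0_coord. Qed.

Lemma lebesgue_rV_fin (S : set V) c r : measurable S -> 0 < r ->
  S `<=` box c r -> lebesgue_rV R N S \is a fin_num.
Proof.
move=> mS r0 SB; rewrite ge0_fin_numE//.
apply: (@le_lt_trans _ _ (lebesgue_rV R N (box c r))).
  by apply: le_measure; rewrite ?inE//; exact: measurable_box.
by rewrite lebesgue_rV_box// ltry.
Qed.

Lemma lebesgue_rV_fin_eball (S : set V) : measurable S -> S `<=` eball 0 1 ->
  lebesgue_rV R N S \is a fin_num.
Proof.
move=> mS SB; apply: (lebesgue_rV_fin mS ltr01).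
by apply: (subset_trans SB); exact: eball0_sub_box.
Qed.

Lemma lebesgue_eball_gt0 : 0 < fine (lebesgue_rV R N (eball 0 1)).
Proof.
have mb := @measurable_eball0 1 ltr01.
have N1 : 1 <= N%:R :> R by rewrite ler1n.
have i0 : 0 < (2 * N%:R)^-1 :> R by rewrite invr_gt0; lra.
rewrite fine_gt0// -ge0_fin_numE// lebesgue_rV_fin_eball// andbT.
apply: (@lt_le_trans _ _ (lebesgue_rV R N (box 0 (2 * N%:R)^-1))).
  by rewrite lebesgue_rV_box// lte_fin exprn_gt0//; lra.
by apply: le_measure; rewrite ?inE//; [exact: measurable_box|exact: box_sub_eball0].
Qed.

Lemma vfrac_box (c : 'rV[R]_N) r : 0 < r ->
  vfrac (box c r) = (2 * r) ^+ N / fine (lebesgue_rV R N (eball 0 1)).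
Proof. by move=> r0; rewrite /vfrac lebesgue_rV_box. Qed.

Lemma vfrac_split (A : set V) (B : set V) c r : measurable A -> measurable B ->
  0 < r -> B `<=` box c r -> vfrac (B `&` A) + vfrac (B `\` A) = vfrac B.
Proof.
move=> mA mB r0 BE; rewrite /vfrac -mulrDl; congr (_ / _).
have mI : measurable (B `&` A) by exact: measurableI.
have mD : measurable (B `\` A) by exact: measurableD.
rewrite -fineD; last 2 first.
- by apply: (lebesgue_rV_fin (c := c) mI r0) => x [/BE].
- by apply: (lebesgue_rV_fin (c := c) mD r0) => x [/BE].
congr fine; rewrite -measureU//.
  by rewrite setUIDK.
by apply/seteqP; split => // x [[_ ?] [_]].
Qed.

Lemma vfrac_translate (x : 'rV[R]_N) (A : set V) : measurable A ->
  vfrac [set y | A (x + y)] = vfrac A.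
Proof. by move=> mA; rewrite /vfrac lebesgue_rV_translate. Qed.

(** The step function [b + t * \1_S] lies below [f] on the unit ball; it is integrated
    explicitly. *)
Lemma ball_average_ge (f : 'rV[R]_N -> R) (M b t : R) (S : set V) :
  measurable_fun [set: V] (f : V -> R) -> (forall y, `|f y| <= M) ->
  measurable S -> S `<=` eball 0 1 ->
  (forall y, eball 0 1 y -> b <= f y) -> (forall y, S y -> b + t <= f y) ->
  b + t * vfrac S <= ball_average f.
Proof.
move=> mf fM mS SB fb fbt; have mb := @measurable_eball0 1 ltr01.
have B0 := lebesgue_eball_gt0.
have Bfin : (lebesgue_rV R N (eball 0 1) < +oo)%E.
  by rewrite -ge0_fin_numE// lebesgue_rV_fin_eball.
have intS : (lebesgue_rV R N).-integrable (eball 0 1) (EFin \o (\1_S : V -> R)).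
  apply: measurable_bounded_integrable => //.
  exists 1; split => // x x1 y _ /=; rewrite (le_trans _ (ltW x1))//.
  by rewrite indicE; case: (_ \in _); rewrite ?normr1 ?normr0.
have intb : (lebesgue_rV R N).-integrable (eball 0 1) (EFin \o (fun=> b : R)).
  apply: measurable_bounded_integrable => //.
  by exists `|b|; split => // x x1 y _ /=; exact: ltW.
have inttS : (lebesgue_rV R N).-integrable (eball 0 1) (EFin \o (fun y => t * (\1_S y : R))).
  exact: (@integrableZl _ _ _ (lebesgue_rV R N) _ mb t _ intS).
have intf : (lebesgue_rV R N).-integrable (eball 0 1) (EFin \o f).
  apply: measurable_bounded_integrable => //; first exact: measurable_funTS.
  exists M; split; first exact: num_real.
  by move=> x x1 y _ /=; rewrite (le_trans (fM y))// ltW.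
rewrite /ball_average ler_pdivlMr// mulrDl /vfrac mulrA divfK ?gt_eqF//.
rewrite -Rintegral_cst// (_ : fine (lebesgue_rV R N S) =
   \int[lebesgue_rV R N]_(y in eball 0 1) (\1_S y)); last first.
  rewrite /Rintegral integral_indic//; congr (fine (lebesgue_rV _ _ _)).
  by rewrite setIidl.
rewrite -RintegralZl// -RintegralD//.
apply: le_Rintegral => //; first exact: (integrableD mb intb inttS).
move=> y yB; rewrite indicE; have [yS|yS] := boolP (y \in S).
  by rewrite mulr1; apply: fbt; exact: set_mem.
by rewrite mulr0 addr0; exact: fb.
Qed.

Lemma ball_averageN (f : 'rV[R]_N -> R) (M : R) :
  measurable_fun [set: V] (f : V -> R) -> (forall y, `|f y| <= M) ->
  ball_average (fun y => - f y) = - ball_average f.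
Proof.
move=> mf fM; have mb := @measurable_eball0 1 ltr01.
rewrite /ball_average -mulNr; congr (_ / _).
under eq_Rintegral do rewrite -mulN1r.
rewrite RintegralZl ?mulN1r//.
apply: measurable_bounded_integrable => //; last 2 first.
- exact: measurable_funTS.
- exists M; split; first exact: num_real.
  by move=> x x1 y _ /=; rewrite (le_trans (fM y))// ltW.
by rewrite -ge0_fin_numE// lebesgue_rV_fin_eball.
Qed.

End lebesgue_rV_theory.

(** * Supersolutions at unit scale *)

(* What is used of [Lminus v <= rho] at scale 1: lower bounds of the second
   differences by constants and by one step function enter the inequality. *)
Definition supersol (R : realType) (N : nat) (Lambda alpha beta rho : R)
    (v : 'rV[R]_N -> R) (x : 'rV[R]_N) : Prop :=
  forall (b b' t : R) (S : set (borel_rV R N)), measurable S -> S `<=` eball 0 1 ->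
    (forall z, eball 0 Lambda z -> b <= delta2 v x z) ->
    (forall y, eball 0 1 y -> b' <= delta2 v x y) ->
    (forall y, S y -> b' + t <= delta2 v x y) ->
    alpha * b + beta * (b' + t * vfrac S) <= 2 * rho.

Section supersol_of_extremal.
Context (R : realType) (N : nat) (Lambda alpha beta eps rho M : R).
Hypothesis N0 : (0 < N)%N.
Hypothesis Lambda_gt0 : 0 < Lambda.
Hypothesis alpha_ge0 : 0 <= alpha.
Hypothesis beta_gt0 : 0 < beta.
Hypothesis eps_gt0 : 0 < eps.
Variable u : 'rV[R]_N -> R.
Hypothesis mu : measurable_fun setT (u : borel_rV R N -> R).
Hypothesis uM : forall x, `|u x| <= M.

Let f (x y : 'rV[R]_N) := delta2 u (eps *: x) (eps *: y).

Let delta2_scale x y : delta2 (fun y => u (eps *: y)) x y = f x y.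
Proof. by rewrite /f /delta2 scalerDr scalerBr. Qed.

Let measurable_f x : measurable_fun [set: borel_rV R N] (f x : borel_rV R N -> R).
Proof.
apply: measurable_funD; last exact: measurable_cst.
have mc (e : R) : measurable_fun [set: borel_rV R N]
    (fun y : borel_rV R N => u (eps *: x + e *: (y : 'rV[R]_N)) : R).
  exact: (measurableT_comp mu (measurable_affine_rV (eps *: x) e)).
apply: measurable_funD; first exact: mc.
by have := mc (- eps); under eq_fun do rewrite scaleNr.
Qed.

Let bounded_f x y : `|f x y| <= 4 * M.
Proof.
have := uM (eps *: x + eps *: y); have := uM (eps *: x - eps *: y).
have := uM (eps *: x); rewrite /f /delta2 !ler_norml.
move=> /andP[? ?] /andP[? ?] /andP[? ?]; apply/andP; lra.
Qed.

Let Ball_nonempty : @eball R N 0 Lambda 0.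
Proof.
by apply/eball0_lt => //; rewrite big1 ?exprn_gt0// => i _; rewrite mxE expr0n.
Qed.

Lemma supersol_Lminus x :
  Lminus Lambda alpha beta eps u (eps *: x) <= rho ->
  supersol Lambda alpha beta (eps ^+ 2 * rho) (fun y => u (eps *: y)) x.
Proof.
rewrite /Lminus mulrC ler_pdivrMr; last by rewrite mulr_gt0// exprn_gt0.
move=> h b b' t S mS SB hb hb' ht.
apply: (@le_trans _ _ (rho * (2 * eps ^+ 2))); last by rewrite le_eqVlt; apply/orP; left; apply/eqP; ring.
apply: le_trans h; apply: lerD.
  apply: ler_wpM2l => //; apply: lb_le_inf.
    by exists (f x 0), 0.
  by move=> _ [z zL <-]; rewrite -[X in _ <= X]delta2_scale; exact: hb.
apply: ler_wpM2l; first exact: ltW.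
apply: (ball_average_ge N0 (measurable_f x) (bounded_f x) mS SB) => y Hy.
  by rewrite -delta2_scale; exact: hb'.
by rewrite -delta2_scale; exact: ht.
Qed.

(** Passing to [- u] reverses second differences, so the supremum in [Lplus] becomes the infimum
    behind [supersol]: one notion serves both inequalities. *)
Lemma supersol_Lplus x :
  - rho <= Lplus Lambda alpha beta eps u (eps *: x) ->
  supersol Lambda alpha beta (eps ^+ 2 * rho) (fun y => - u (eps *: y)) x.
Proof.
rewrite /Lplus mulrC ler_pdivlMr; last by rewrite mulr_gt0// exprn_gt0.
move=> h b b' t S mS SB hb hb' ht.
have dN y : delta2 (fun y => - u (eps *: y)) x y = - f x y.
  by rewrite -delta2_scale /delta2; ring.
have h1 : sup [set delta2 u (eps *: x) (eps *: z) | z in eball 0 Lambda] <= - b.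
  apply: ge_sup; first by exists (f x 0), 0.
  by move=> _ [z zL <-]; have := hb z zL; rewrite dN lerNr.
have h2 : b' + t * vfrac S <= - ball_average (f x).
  rewrite -(ball_averageN (measurable_f x) (bounded_f x)).
  apply: (@ball_average_ge _ _ N0 _ (4 * M)) => //.
  - by apply: measurableT_comp => //; exact: measurable_f.
  - by move=> y; rewrite normrN bounded_f.
  - by move=> y Hy; rewrite -dN; exact: hb'.
  - by move=> y Hy; rewrite -dN; exact: ht.
have h1' := ler_wpM2l alpha_ge0 h1; have h2' := ler_wpM2l (ltW beta_gt0) h2.
move: h h1' h2'; rewrite /f mulrN; set p := _ * sup _; set q := ball_average _.
set w := eps ^+ 2; set g := b' + _ => h h1' h2'.
by rewrite mulrN in h2'; lra.
Qed.

End supersol_of_extremal.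

(** * Scalar products, and boxes placed in a given direction *)

Section dot.
Context (R : realType) (N : nat).
Implicit Types (x y z : 'rV[R]_N).

Definition dot x y : R := \sum_i x 0 i * y 0 i.
Definition sq x : R := \sum_i x 0 i ^+ 2.

Lemma sq_ge0 x : 0 <= sq x.
Proof. by apply: sumr_ge0 => i _; exact: sqr_ge0. Qed.

Lemma sqD x y : sq (x + y) = sq x + 2 * dot x y + sq y.
Proof.
rewrite /sq /dot mulr_sumr -!big_split/=; apply: eq_bigr => i _; rewrite mxE; ring.
Qed.

Lemma dotC x y : dot x y = dot y x.
Proof. by apply: eq_bigr => i _; rewrite mulrC. Qed.

Lemma dotN x y : dot x (- y) = - dot x y.
Proof. by rewrite /dot -sumrN; apply: eq_bigr => i _; rewrite mxE mulrN. Qed.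

Lemma dotD x y z : dot x (y + z) = dot x y + dot x z.
Proof. by rewrite /dot -big_split; apply: eq_bigr => i _; rewrite mxE mulrDr. Qed.

Lemma dotZ x c y : dot x (c *: y) = c * dot x y.
Proof. by rewrite /dot mulr_sumr; apply: eq_bigr => i _; rewrite mxE; ring. Qed.

Lemma sqN x : sq (- x) = sq x.
Proof. by apply: eq_bigr => i _; rewrite mxE sqrrN. Qed.

Lemma dotxx x : dot x x = sq x.
Proof. by apply: eq_bigr => i _; rewrite expr2. Qed.

Lemma enorm_sq x : enorm x ^+ 2 = sq x.
Proof. by rewrite /enorm sqr_sqrtr// sq_ge0. Qed.

Lemma dot_coord_le x y r : (forall i, `|y 0 i| <= r) ->
  `|dot x y| <= N%:R * r * enorm x.
Proof.
move=> h; apply: (le_trans (ler_norm_sum _ _ _)).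
have -> : N%:R * r * enorm x = \sum_(i < N) r * enorm x.
  by rewrite sumr_const card_ord -mulrA mulr_natl.
apply: ler_sum => i _; rewrite normrM mulrC.
by apply: ler_pM => //; exact: coord_le_enorm.
Qed.

(** At the centre of the box the product is |x|/2; moving each coordinate by at most 1/(16N) changes
    it by at most |x|/16. *)
Lemma dot_box_ge x y : (0 < N)%N -> x != 0 ->
  box ((2 * enorm x)^-1 *: x) (16 * N%:R)^-1 y -> 7 / 16 * enorm x <= dot x y.
Proof.
move=> N0 x0 hy; set c := _ *: x in hy.
have -> : y = c + (y - c) by rewrite addrC subrK.
have N1 : 1 <= N%:R :> R by rewrite ler1n.
have e0 : 0 < enorm x.
  rewrite lt_neqAle enorm_ge0 andbT eq_sym; apply: contra x0 => /eqP e0.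
  have s0 : sq x = 0 by rewrite -enorm_sq e0 expr0n.
  apply/eqP/rowP => i; rewrite mxE; apply/eqP; rewrite -sqrf_eq0.
  have /psumr_eq0P := s0; move=> /(_ (fun i _ => sqr_ge0 _)) /(_ i isT).
  by move=> ->.
rewrite dotD dotZ dotxx -enorm_sq.
have -> : (2 * enorm x)^-1 * enorm x ^+ 2 = enorm x / 2 by field; lra.
have Na : N%:R * (16 * N%:R)^-1 = 16^-1 :> R by field; lra.
have h i : `|(y - c) 0 i| <= (16 * N%:R)^-1 by have /ltW := hy i; rewrite !mxE.
have := @dot_coord_le x (y - c) (16 * N%:R)^-1 h; rewrite Na.
by rewrite ler_norml => /andP[? _]; lra.
Qed.

Lemma box_sub_eball0_dir x : (0 < N)%N ->
  box ((2 * enorm x)^-1 *: x) (16 * N%:R)^-1 `<=` eball 0 1.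
Proof.
move=> N0 y hy; apply/eball0_lt => //; rewrite -/(sq y) expr1n.
set c := _ *: x in hy.
have -> : y = c + (y - c) by rewrite addrC subrK.
have N1 : 1 <= N%:R :> R by rewrite ler1n.
have ec : enorm c <= 2^-1.
  rewrite /c enormZ; have := enorm_ge0 x; rewrite le_eqVlt => /predU1P[<-|e0].
    by rewrite mulr0.
  by rewrite ger0_norm ?invr_ge0; [rewrite invfM -mulrA mulVf ?gt_eqF ?mulr1|lra].
have h i : `|(y - c) 0 i| <= (16 * N%:R)^-1 by have /ltW := hy i; rewrite !mxE.
have h1 := @dot_coord_le c (y - c) (16 * N%:R)^-1 h.
have h2 := sumsq_le h; rewrite -/(sq _) in h2.
rewrite sqD -enorm_sq.
have Na : N%:R * (16 * N%:R)^-1 = 16^-1 :> R by field; lra.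
have a16 : (16 * N%:R)^-1 <= 16^-1 :> R by rewrite lef_pV2 ?posrE; lra.
have a0 : 0 < (16 * N%:R)^-1 :> R by rewrite invr_gt0; lra.
rewrite Na ler_norml in h1; move: h1 => /andP[_ h1].
have := enorm_ge0 c.
by nra.
Qed.

End dot.

(** Half the side of a cell. It is small enough that a box of this half-side stays in the unit ball
    when its centre is within [2 * mesh] of the origin in each coordinate, and that products with x
    vary by at most |x|/16 around its centre. *)
Definition mesh (R : realType) (N : nat) : R := (16 * N%:R)^-1.

Definition mesh_frac (R : realType) (N : nat) : R :=
  vfrac (box (0 : 'rV[R]_N) (mesh R N)).

Section mesh_theory.
Context (R : realType) (N : nat).
Hypothesis N0 : (0 < N)%N.
Local Notation a := (mesh R N).
Local Notation c1 := (mesh_frac R N).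

Lemma mesh_gt0 : 0 < a.
Proof.
have N1 : 1 <= N%:R :> R by rewrite ler1n.
by rewrite invr_gt0; lra.
Qed.

Lemma natr_mesh : N%:R * a = 16^-1.
Proof.
have N1 : 1 <= N%:R :> R by rewrite ler1n.
by rewrite /mesh; field; lra.
Qed.

Lemma mesh_le : a <= 16^-1.
Proof.
have N1 : 1 <= N%:R :> R by rewrite ler1n.
by rewrite lef_pV2 ?posrE; lra.
Qed.

Lemma vfrac_box_mesh (c : 'rV[R]_N) : vfrac (box c a) = c1.
Proof. by rewrite /mesh_frac !vfrac_box// mesh_gt0. Qed.

Lemma mesh_frac_gt0 : 0 < c1.
Proof.
rewrite /mesh_frac vfrac_box ?mesh_gt0// divr_gt0 ?lebesgue_eball_gt0//.
by rewrite exprn_gt0// mulr_gt0// mesh_gt0.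
Qed.

Lemma box_mesh_sub_eball0 (p : 'rV[R]_N) : (forall i, `|p 0 i| <= 2 * a) ->
  box p a `<=` eball 0 1.
Proof.
move=> hp y hy; apply: box_sub_eball0 => // i.
rewrite mxE subr0.
have := ler_normD (y 0 i - p 0 i) (p 0 i); rewrite subrK => /le_lt_trans; apply.
have N1 : 1 <= N%:R :> R by rewrite ler1n.
have -> : (2 * N%:R)^-1 = 8 * a by rewrite /mesh; field; lra.
by have := hy i; have := hp i; have := mesh_gt0; lra.
Qed.

Lemma mesh_frac_le1 : c1 <= 1.
Proof.
have h0 : @box R N 0 a `<=` eball 0 1.
  by apply: box_mesh_sub_eball0 => i; rewrite mxE normr0; have := mesh_gt0; lra.
rewrite /mesh_frac /vfrac ler_pdivrMr ?lebesgue_eball_gt0// mul1r.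
have mb := @measurable_box R N 0 a; have mB := @measurable_eball0 R N 1 ltr01.
apply: fine_le; rewrite ?lebesgue_rV_fin_eball//.
by apply: le_measure; rewrite ?inE.
Qed.

End mesh_theory.

(** * Propagation of lower bounds from cell to cell *)

Section chain.
Context (R : realType) (N : nat) (Lambda alpha beta : R).
Hypothesis N0 : (0 < N)%N.
Hypothesis Lambda_ge1 : 1 <= Lambda.
Hypothesis alpha_ge0 : 0 <= alpha.
Hypothesis beta_gt0 : 0 < beta.
Hypothesis ab1 : alpha + beta = 1.
Local Notation a := (mesh R N).
Local Notation c1 := (mesh_frac R N).
Implicit Types (v : 'rV[R]_N -> R) (x y z c : 'rV[R]_N).

Lemma supersol_box rho v x b b' t p : supersol Lambda alpha beta rho v x ->
  box p a `<=` eball 0 1 ->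
  (forall z, eball 0 Lambda z -> b <= delta2 v x z) ->
  (forall y, eball 0 1 y -> b' <= delta2 v x y) ->
  (forall y, box p a y -> b' + t <= delta2 v x y) ->
  alpha * b + beta * (b' + t * c1) <= 2 * rho.
Proof.
move=> sv pB hb hb' ht; rewrite -(vfrac_box_mesh N0 p).
by apply: sv => //; exact: measurable_box.
Qed.

(** Where [v] is nonnegative its second differences at [x] are at least [- 2 * v x], with the
    surplus [t] on [S]; by [alpha + beta = 1] the two constants combine to [- 2 * v x]. *)
Lemma supersol_nonneg_lower rho v x t S : supersol Lambda alpha beta rho v x ->
  (forall y, box x Lambda y -> 0 <= v y) ->
  measurable (S : set (borel_rV R N)) -> S `<=` eball 0 1 ->
  (forall y, S y -> t <= v (x + y)) ->
  beta / 2 * (t * vfrac S) - rho <= v x.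
Proof.
move=> sv v0 mS SB hS.
have hz z : eball 0 Lambda z -> 0 <= v (x + z) /\ 0 <= v (x - z).
  move=> zL; split; apply: v0 => i; rewrite !mxE.
    by rewrite addrAC subrr add0r; exact: eball0_coord.
  by rewrite addrAC subrr add0r normrN; exact: eball0_coord.
have hy y : eball 0 1 y -> 0 <= v (x + y) /\ 0 <= v (x - y).
  by move=> y1; apply: hz; exact: lt_le_trans y1 Lambda_ge1.
have := sv (- 2 * v x) (- 2 * v x) t S mS SB.
have h1 z : eball 0 Lambda z -> - 2 * v x <= delta2 v x z.
  by move=> /hz[? ?]; rewrite /delta2; lra.
have h2 y : eball 0 1 y -> - 2 * v x <= delta2 v x y.
  by move=> /hy[? ?]; rewrite /delta2; lra.
have h3 y : S y -> - 2 * v x + t <= delta2 v x y.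
  by move=> Sy; have := hS y Sy; have [? ?] := hy y (SB y Sy); rewrite /delta2; lra.
move=> /(_ h1 h2 h3).
have -> : alpha = 1 - beta by rewrite -ab1 addrK.
nra.
Qed.

Lemma spread_step rho v x c r m : supersol Lambda alpha beta rho v x ->
  (forall y, box x Lambda y -> 0 <= v y) -> a <= r -> box c (r + a) x ->
  (forall y, box c r y -> m <= v y) -> beta * c1 / 2 * m - rho <= v x.
Proof.
move=> sv v0 ar hx hm; have a0 := mesh_gt0 R N0.
(* Contraction towards [c] with [l * (r + a) = r - a]: the contracted point carries a mesh box
   inside the old box, and it has moved by at most [(1 - l) * (r + a) = 2 * a] in each
   coordinate. *)
pose l := (r - a) / (r + a).
pose p := c + l *: (x - c) - x.
have l1 : 1 - l = 2 * a / (r + a) by rewrite /l; field; lra.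
have l1p : l * (r + a) = r - a by rewrite /l divfK//; lra.
have l0 : 0 <= l by apply: divr_ge0; lra.
have l10 : 0 <= 1 - l by rewrite l1; apply: divr_ge0; lra.
have pB : box p a `<=` eball 0 1.
  apply: box_mesh_sub_eball0 => // i; rewrite !mxE.
  rewrite (_ : _ - _ = - ((1 - l) * (x 0 i - c 0 i))); last by ring.
  rewrite normrN normrM (ger0_norm l10).
  have := hx i; have : (1 - l) * (r + a) = 2 * a by rewrite mulrBl l1p; ring.
  by nra.
have := @supersol_nonneg_lower rho v x m (box p a) sv v0 (measurable_box _ _) pB.
rewrite vfrac_box_mesh// => /(_ _)H.
rewrite (_ : beta * c1 / 2 * m = beta / 2 * (m * c1)); last by ring.
apply: H => y hy; apply: hm => i; rewrite !mxE.
have := hy i; rewrite !mxE => {}hy.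
rewrite (_ : _ - _ = (y 0 i - (c 0 i + l * (x 0 i - c 0 i) - x 0 i)) + l * (x 0 i - c 0 i)); last by ring.
apply: (le_lt_trans (ler_normD _ _)); rewrite normrM (ger0_norm l0).
have := hx i; have := normr_ge0 (x 0 i - c 0 i).
by nra.
Qed.

(** Each step enlarges the box by one mesh and costs the factor [beta * c1 / 2]. As this is at most
    1/2, the errors [rho] of all steps add up to at most [2 * rho]. *)
Lemma spread rho v c L m k : 0 <= rho ->
  (forall y, box c L y -> 0 <= v y) ->
  (forall y, box c L y -> supersol Lambda alpha beta rho v y) ->
  k.+1%:R * a + Lambda <= L ->
  (forall y, box c a y -> m <= v y) ->
  forall y, box c (k.+1%:R * a) y -> (beta * c1 / 2) ^+ k * m - 2 * rho <= v y.
Proof.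
move=> rho0 v0 sv kL hm; have a0 := mesh_gt0 R N0; have L1 := Lambda_ge1.
have c10 := mesh_frac_gt0 R N0; have c11 := mesh_frac_le1 R N0.
have th0 : 0 <= beta * c1 / 2 by rewrite divr_ge0// mulr_ge0 ?ltW.
have b1 : beta <= 1 by rewrite -ab1 lerDr.
have th1 : beta * c1 / 2 <= 1 / 2 by nra.
elim: k kL => [|k IH] kL y hy.
  by rewrite mul1r in hy; have := hm y hy; rewrite expr0 mul1r; lra.
have kk : k.+2%:R * a = k.+1%:R * a + a by rewrite -[k.+2%:R]natr1; ring.
rewrite kk in kL hy.
have hyL : box c L y by move=> i; apply: lt_le_trans (hy i) _; lra.
have h : beta * c1 / 2 * ((beta * c1 / 2) ^+ k * m - 2 * rho) - rho <= v y.
  apply: (@spread_step rho v y c (k.+1%:R * a)) => //.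
  - exact: sv.
  - move=> z hz; apply: v0 => i.
    have -> : z 0 i - c 0 i = (z 0 i - y 0 i) + (y 0 i - c 0 i) by ring.
    apply: (le_lt_trans (ler_normD _ _)); have := hz i; have := hy i; lra.
  - by apply: ler_peMl; [exact: ltW|rewrite ler1n].
  - by apply: IH; lra.
rewrite exprS -mulrA; apply: le_trans h; nra.
Qed.

End chain.

(** * The barrier and the sliding paraboloids *)

(** For t = 2s with s nonnegative, put E = e^s and F = e^-s. Then E F = 1 gives E^2 + F^2 = 2 + (E -
    F)^2, and E - F is at least s because E >= 1 + s and F <= 1. *)
Lemma cosh_lower (R : realType) (t : R) : 2 + t ^+ 2 / 4 <= expR t + expR (- t).
Proof.
have e1 (s : R) : expR s * expR (- s) = 1 by rewrite expRxMexpNx_1.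
have key (s : R) : 0 <= s -> 2 + (2 * s) ^+ 2 / 4 <= expR (2 * s) + expR (- (2 * s)).
  move=> s0; rewrite (_ : 2 * s = s + s); last by ring.
  rewrite opprD !expRD; have := e1 s; have := expR_ge1Dx s; have := expR_gt0 (- s).
  set E := expR s; set F := expR (- s) => F0 E1 EF.
  have F1 : F <= 1 by nra.
  have EF1 : 0 <= s <= E - F by apply/andP; split; lra.
  nra.
have [t0|t0] := leP 0 t.
  by have := key (t / 2); rewrite (_ : 2 * (t / 2) = t); [apply; lra|field].
have h : 0 <= - t / 2 by lra.
have := key _ h; rewrite (_ : 2 * (- t / 2) = - t); last by field.
by rewrite opprK sqrrN [X in _ <= X -> _]addrC.
Qed.

Lemma approx_inf (R : realType) (T : Type) (D : set T) (f : T -> R) (m eta : R) :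
  D !=set0 -> (forall x, D x -> m <= f x) -> 0 < eta ->
  exists2 x, D x & forall y, D y -> f x - eta <= f y.
Proof.
move=> [x0 Dx0] fm eta0.
have hi : has_inf (f @` D).
  by split; [exists (f x0), x0|exists m => _ [x Dx <-]; exact: fm].
have [_ [x Dx <-] hx] := inf_adherent eta0 hi.
exists x => // y Dy; rewrite lerBlDr (le_trans (ltW hx))// lerD2r.
by apply: ge_inf; [exact: (proj2 hi)|exists y].
Qed.

Section gauss.
Context (R : realType) (N : nat).
Implicit Types (x y q : 'rV[R]_N).

Implicit Types (k : R).

Definition gauss k q x : R := expR (- (k * sq (x - q))).

Lemma gauss_le1 k q x : 0 <= k -> gauss k q x <= 1.
Proof. by move=> k0; rewrite -expR0 ler_expR oppr_le0 mulr_ge0// sq_ge0. Qed.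

Lemma gaussD k q x y : gauss k q (x + y) =
  gauss k q x * (expR (- (k * sq y)) * expR (- (2 * k * dot (x - q) y))).
Proof. by rewrite /gauss -!expRD (addrAC x) (sqD (x - q) y); congr expR; ring. Qed.

Lemma delta2_gauss k q x y : delta2 (gauss k q) x y = gauss k q x *
  (expR (- (k * sq y)) *
    (expR (2 * k * dot (x - q) y) + expR (- (2 * k * dot (x - q) y))) - 2).
Proof.
rewrite /delta2 !gaussD sqN dotN; set d := dot _ _.
by rewrite (_ : - (2 * k * - d) = 2 * k * d); ring.
Qed.

Lemma delta2_gauss_ge k q x y :
  gauss k q x * (- (2 * k * sq y)) <= delta2 (gauss k q) x y.
Proof.
rewrite delta2_gauss; apply: ler_wpM2l; first exact: expR_ge0.
have := cosh_lower (2 * k * dot (x - q) y); have := expR_ge1Dx (- (k * sq y)).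
have := expR_ge0 (- (k * sq y)); have := sqr_ge0 (2 * k * dot (x - q) y).
set E := expR (- (k * sq y)); set C := _ + expR _; set D := _ ^+ 2.
by nra.
Qed.

(** The factor e^(-k|y|^2) is at least 1 - k|y|^2, hence at least 1/2, and so keeps half of the
    convexity supplied by [cosh_lower]. This is the bound for the average; the cruder
    [delta2_gauss_ge] is enough for the infimum. *)
Lemma delta2_gauss_ge_dot k q x y : 0 <= k -> k * sq y <= 1 / 2 ->
  gauss k q x * (k ^+ 2 * dot (x - q) y ^+ 2 / 2 - 2 * k * sq y)
  <= delta2 (gauss k q) x y.
Proof.
move=> k0 ky; rewrite delta2_gauss; apply: ler_wpM2l; first exact: expR_ge0.
have := cosh_lower (2 * k * dot (x - q) y); have := expR_ge1Dx (- (k * sq y)).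
have -> : (2 * k * dot (x - q) y) ^+ 2 = 4 * (k ^+ 2 * dot (x - q) y ^+ 2) by ring.
have := expR_ge0 (- (k * sq y)); have := mulr_ge0 (sqr_ge0 k) (sqr_ge0 (dot (x - q) y)).
rewrite -mulrA; set E := expR (- (k * sq y)); set C := _ + expR _; set D := _ * _ ^+ 2.
move=> D0 E0 E1 C2.
have : (1 - k * sq y) * (2 + D) <= E * C.
  apply: ler_pM; lra.
by nra.
Qed.

End gauss.

(** * The inequality at a contact point *)

Section contact.
Context (R : realType) (N : nat) (Lambda alpha beta : R).
Hypothesis N0 : (0 < N)%N.
Hypothesis Lambda_ge1 : 1 <= Lambda.
Hypothesis beta_gt0 : 0 < beta.
Hypothesis ab1 : alpha + beta = 1.
Local Notation a := (mesh R N).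
Local Notation c1 := (mesh_frac R N).
Implicit Types (u : 'rV[R]_N -> R) (x y z q : 'rV[R]_N).

Implicit Types (rho kap k A eta tau : R).

(* Minimizing [gap] amounts to touching [u] from below by the barrier minus a
   paraboloid with vertex [y]. *)
Definition gap u kap k q A y x := u x - kap * gauss k q x + A * sq (x - y).

Lemma delta2_gap u kap k q A y x z : delta2 u x z =
  delta2 (gap u kap k q A y) x z + kap * delta2 (gauss k q) x z - 2 * A * sq z.
Proof.
rewrite /delta2 /gap.
have -> : x + z - y = (x - y) + z by rewrite addrAC.
have -> : x - z - y = (x - y) + (- z) by rewrite addrAC.
rewrite (sqD (x - y) z) (sqD (x - y) (- z)) dotN (sqN z); ring.
Qed.

(** At an approximate minimum the second differences of the gap are at least [- 2 * eta], so those
    of [u] are controlled by barrier and paraboloid. The surplus [tau] may come from the convexity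
    of the Gaussian along [x - q], as in [touch], or from the growth of the gap, as in [touch_sep].
    The losses on the unit ball are absorbed into those on the ball of radius [Lambda], since
    [Lambda] is at least 1. *)
Lemma contact_bound rho u kap k q A y x eta p tau :
  supersol Lambda alpha beta rho u x -> 0 <= kap -> 0 <= k -> k <= 1 / 2 -> 0 <= A ->
  (forall x', box x Lambda x' -> gap u kap k q A y x - eta <= gap u kap k q A y x') ->
  box p a `<=` eball 0 1 ->
  (forall z, box p a z -> tau <= kap * gauss k q x * (k ^+ 2 * dot (x - q) z ^+ 2 / 2)
      + (gap u kap k q A y (x + z) - gap u kap k q A y x + eta)) ->
  beta * c1 * tau <= 2 * rho + 2 * eta + 2 * Lambda ^+ 2 * (kap * gauss k q x * k + A).
Proof.
move=> su kap0 k0 k1 A0 hmin pB htau; have L1 := Lambda_ge1.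
have g0 : 0 <= gauss k q x by exact: expR_ge0.
have P0 : 0 <= kap * gauss k q x by exact: mulr_ge0.
have hz z : eball 0 Lambda z -> - 2 * eta <= delta2 (gap u kap k q A y) x z.
  move=> zL; rewrite /delta2.
  have := hmin (x + z); have := hmin (x - z).
  have h1 : box x Lambda (x + z).
    by move=> i; rewrite !mxE addrAC subrr add0r; exact: eball0_coord.
  have h2 : box x Lambda (x - z).
    by move=> i; rewrite !mxE addrAC subrr add0r normrN; exact: eball0_coord.
  by move=> /(_ h2) ? /(_ h1) ?; lra.
have sqL z : eball 0 Lambda z -> sq z <= Lambda ^+ 2.
  by move=> /eball0_lt => /(_ (lt_le_trans ltr01 L1))/ltW.
have sq1 z : eball 0 1 z -> sq z <= 1.
  by move=> /eball0_lt => /(_ ltr01)/ltW; rewrite expr1n.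
have B1L z : eball 0 1 z -> eball 0 Lambda z.
  by move=> z1; exact: lt_le_trans z1 L1.
set P := kap * gauss k q x in P0 htau *.
have dL z : eball 0 Lambda z ->
    - 2 * eta - 2 * Lambda ^+ 2 * (P * k + A) <= delta2 u x z.
  move=> zL; rewrite (delta2_gap u kap k q A y).
  have := hz z zL; have := sqL z zL; have := sq_ge0 z.
  have := ler_wpM2l kap0 (delta2_gauss_ge k q x z); rewrite mulrA -/P.
  move: (delta2 _ _ _) (delta2 _ _ _) (sq z) => d1 d2 w h1 w0 wL h2.
  have Pk : 0 <= P * k by exact: mulr_ge0.
  have : 0 <= (P * k + A) * (Lambda ^+ 2 - w) by apply: mulr_ge0; lra.
  by nra.
have dP z : eball 0 1 z -> - 2 * eta - 2 * (P * k + A) +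
    (P * (k ^+ 2 * dot (x - q) z ^+ 2 / 2) +
     (gap u kap k q A y (x + z) - gap u kap k q A y x + eta)) <= delta2 u x z.
  move=> z1; rewrite (delta2_gap u kap k q A y).
  have h2 : box x Lambda (x - z).
    move=> i; rewrite !mxE addrAC subrr add0r normrN; apply: eball0_coord.
    exact: B1L.
  have z2 := sq1 z z1; have z0 := sq_ge0 z.
  have kz : k * sq z <= 1 / 2 by nra.
  have := hmin _ h2; have := ler_wpM2l kap0 (delta2_gauss_ge_dot q x k0 kz).
  rewrite (mulrA kap (gauss k q x)) -/P /(delta2 (gap _ _ _ _ _ _)).
  set d := k ^+ 2 * _; move: (sq z) (gap _ _ _ _ _ _ _) (gap _ _ _ _ _ _ _)
    (gap _ _ _ _ _ _ _) (delta2 _ _ _) z2 z0 => w g1 g2 g3 d2 z2 z0 h1 h3.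
  have Pk : 0 <= P * k by exact: mulr_ge0.
  have : 0 <= (P * k + A) * (1 - w) by apply: mulr_ge0; lra.
  by nra.
have d1 z : eball 0 1 z -> - 2 * eta - 2 * (P * k + A) <= delta2 u x z.
  move=> z1; apply: le_trans (dP z z1).
  have h2 : box x Lambda (x + z).
    move=> i; rewrite !mxE addrAC subrr add0r; apply: eball0_coord.
    exact: B1L.
  have := hmin _ h2.
  have : 0 <= P * (k ^+ 2 * dot (x - q) z ^+ 2 / 2).
    by rewrite mulr_ge0// divr_ge0// mulr_ge0// sqr_ge0.
  by lra.
have := @supersol_box R N Lambda alpha beta N0 rho u x _ _ tau p su pB dL d1.
have H z : box p a z -> - 2 * eta - 2 * (P * k + A) + tau <= delta2 u x z.
  move=> zp; apply: le_trans (dP z (pB z zp)); rewrite lerD2l; exact: htau.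
move=> /(_ H).
have -> : alpha = 1 - beta by rewrite -ab1 addrK.
have Pk : 0 <= P * k by exact: mulr_ge0.
have L2 : 0 <= (Lambda ^+ 2 - 1) * (P * k + A).
  apply: mulr_ge0; last by lra.
  by nra.
have b0 := beta_gt0.
by nra.
Qed.

End contact.

(** * Location of the contact points and separation of the vertices *)

Section touching.
Context (R : realType) (N : nat) (Lambda alpha beta : R).
Hypothesis N0 : (0 < N)%N.
Hypothesis Lambda_ge1 : 1 <= Lambda.
Hypothesis beta_gt0 : 0 < beta.
Hypothesis ab1 : alpha + beta = 1.
Local Notation a := (mesh R N).
Local Notation c1 := (mesh_frac R N).
Local Notation n := (N%:R : R).

(** Constants free of the scale s: the Gaussian has exponent K/s^2, the paraboloid coefficient
    A/(2s^2), the minimizers are exact up to eta1/s^2, and rho is at most rho1/s^2. [K_large] makes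
    the Gaussian convex on average away from its centre; [kap_large] makes the barrier drop by 2
    between the squared radii 4Ns^2 and 16Ns^2; [g] bounds [kap * K] times the Gaussian from below
    on the larger ball and dominates the errors. *)
Variables K kap A eta1 rho1 : R.
Hypothesis K_ge1 : 1 <= K.
Hypothesis K_large : 2 * Lambda ^+ 2 + 1 <= beta * c1 * K / 200.
Hypothesis kap_ge0 : 0 <= kap.
Hypothesis kap_large : 2 <= kap * (expR (- (4 * n * K)) - expR (- (16 * n * K))).
Let g := kap * K * expR (- (16 * n * K)).
Hypothesis A_gt0 : 0 < A.
Hypothesis A_n : A * (9 * n) <= 1.
Hypothesis A_g : Lambda ^+ 2 * A <= g / 4.
Hypothesis eta_gt0 : 0 < eta1.
Hypothesis eta_4 : eta1 <= 1 / 4.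
Hypothesis eta_g : eta1 <= g / 16.
Hypothesis rho_ge0 : 0 <= rho1.
Hypothesis rho_g : rho1 <= g / 16.

Implicit Types (x y z q : 'rV[R]_N) (u : 'rV[R]_N -> R) (s rho : R).

Lemma coord_lt_sq x r i : 0 <= r -> sq x < r ^+ 2 -> `|x 0 i| < r.
Proof.
move=> r0 h; apply: le_lt_trans (coord_le_enorm x i) _.
by rewrite -(@ltr_pXn2r _ 2)// ?nnegrE ?enorm_ge0// enorm_sq.
Qed.

(** At [x0] the function is below 1 and the paraboloid costs at most 1/2, so the gap is below 3/2 -
    kap e^(-4NK). Beyond the squared radius 16Ns^2 it is at least -kap e^(-16NK). The drop 2 of the
    barrier exceeds 3/2 plus the error 1/4. *)
Lemma touch_near u s q x0 y : 0 < s -> K / s ^+ 2 <= 1 / 2 ->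
  (forall x, box q (4 * n * s + Lambda) x -> 0 <= u x) ->
  (forall i, `|(x0 - q) 0 i| <= 2 * s) -> u x0 < 1 ->
  (forall i, `|(y - q) 0 i| <= s) ->
  exists x, [/\ sq (x - q) < 16 * n * s ^+ 2, u x < kap + 2,
    box q (4 * n * s + Lambda) x &
    forall x', box q (4 * n * s + Lambda) x' ->
      gap u kap (K / s ^+ 2) q (A / (2 * s ^+ 2)) y x - eta1 / s ^+ 2
      <= gap u kap (K / s ^+ 2) q (A / (2 * s ^+ 2)) y x'].
Proof.
move=> s0 Ks u0 hx0 ux0 hy.
have n1 : 1 <= n by rewrite ler1n.
have L1 := Lambda_ge1; have K1 := K_ge1; have e0 := eta_gt0; have e4 := eta_4.
have A0 := A_gt0; have An := A_n; have kap0 := kap_ge0.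
have ss : 0 < s ^+ 2 by rewrite exprn_gt0.
set k := K / s ^+ 2; set A' := A / (2 * s ^+ 2); set eta := eta1 / s ^+ 2.
have k0 : 0 <= k by apply: divr_ge0; lra.
have ks : k * s ^+ 2 = K by rewrite /k divfK// gt_eqF.
have A's : A' * s ^+ 2 = A / 2 by rewrite /A'; field; rewrite gt_eqF.
have A'0 : 0 <= A' by apply: divr_ge0; lra.
have es : eta * s ^+ 2 = eta1 by rewrite /eta divfK// gt_eqF.
have eta0 : 0 < eta by apply: divr_gt0.
have eta4 : eta <= 1 / 4.
  have : 2 <= s ^+ 2 by rewrite -/k in Ks; nra.
  by nra.
have D0 : box q (4 * n * s + Lambda) x0.
  by move=> i; have := hx0 i; rewrite !mxE; nra.
have sqx0 : sq (x0 - q) <= 4 * n * s ^+ 2.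
  by have := sumsq_le hx0; rewrite -/(sq _) exprMn; lra.
have sqxy : sq (x0 - y) <= 9 * n * s ^+ 2.
  have := @sumsq_le R N (x0 - y) (3 * s); rewrite -/(sq _) exprMn.
  move=> /(_ _)H; apply: le_trans (H _) _; last by lra.
  move=> i; have -> : (x0 - y) 0 i = (x0 - q) 0 i - (y - q) 0 i by rewrite !mxE; ring.
  by apply: le_trans (ler_normB _ _) _; have := hx0 i; have := hy i; lra.
have glow x : sq (x - q) <= 4 * n * s ^+ 2 -> expR (- (4 * n * K)) <= gauss k q x.
  move=> h; rewrite ler_expR lerN2 -ks; have := ler_wpM2l k0 h; lra.
have gup x : 16 * n * s ^+ 2 <= sq (x - q) -> gauss k q x <= expR (- (16 * n * K)).
  move=> h; rewrite ler_expR lerN2 -ks; have := ler_wpM2l k0 h; lra.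
have gap_lb x : box q (4 * n * s + Lambda) x -> - kap <= gap u kap k q A' y x.
  move=> Dx; rewrite /gap; have := u0 x Dx; have := gauss_le1 q x k0.
  have := sq_ge0 (x - y); nra.
have [x Dx hx] := approx_inf (ex_intro _ x0 D0) gap_lb eta0.
have gx0 : gap u kap k q A' y x0 < 3 / 2 - kap * expR (- (4 * n * K)).
  rewrite /gap; have := ler_wpM2l kap0 (glow x0 sqx0).
  have := ler_wpM2l A'0 sqxy.
  have : A' * (9 * n * s ^+ 2) <= 1 / 2.
    rewrite (_ : A' * (9 * n * s ^+ 2) = (A' * s ^+ 2) * (9 * n)); last by ring.
    by rewrite A's; lra.
  by lra.
have hx_x0 := hx x0 D0.
exists x; split => //.
- rewrite ltNge; apply/negP => far.
  have := ler_wpM2l kap0 (gup x far); have := kap_large.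
  have := mulr_ge0 A'0 (sq_ge0 (x - y)); have := u0 x Dx.
  by move: hx_x0; rewrite {1}/gap; lra.
- have := mulr_ge0 A'0 (sq_ge0 (x - y)); have := gauss_le1 q x k0.
  have : 0 <= kap * expR (- (4 * n * K)) by rewrite mulr_ge0// expR_ge0.
  by move: hx_x0; rewrite {1}/gap; nra.
Qed.

Lemma box_near q x s : 0 < s -> sq (x - q) < 16 * n * s ^+ 2 ->
  forall x', box x Lambda x' -> box q (4 * n * s + Lambda) x'.
Proof.
move=> s0 near x' hx' i.
have n1 : 1 <= n by rewrite ler1n.
have -> : x' 0 i - q 0 i = (x' 0 i - x 0 i) + (x - q) 0 i by rewrite !mxE; ring.
apply: le_lt_trans (ler_normD _ _) _.
have : `|(x - q) 0 i| < 4 * n * s.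
  apply: coord_lt_sq; first by rewrite !mulr_ge0; lra.
  apply: lt_le_trans near _; have := sqr_ge0 s; rewrite !exprMn; nra.
by have := hx' i; lra.
Qed.

(* At a contact point outside the ball of radius s/4 the barrier would be a
   strict subsolution. *)
Lemma touch rho u s q x0 y : 0 < s -> K / s ^+ 2 <= 1 / 2 ->
  rho * s ^+ 2 <= rho1 ->
  (forall x, box q (4 * n * s + Lambda) x -> 0 <= u x) ->
  (forall x, box q (4 * n * s + Lambda) x -> supersol Lambda alpha beta rho u x) ->
  (forall i, `|(x0 - q) 0 i| <= 2 * s) -> u x0 < 1 ->
  (forall i, `|(y - q) 0 i| <= s) ->
  exists x, [/\ sq (x - q) < s ^+ 2 / 16, u x < kap + 2 &
    forall x', box q (4 * n * s + Lambda) x' ->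
      gap u kap (K / s ^+ 2) q (A / (2 * s ^+ 2)) y x - eta1 / s ^+ 2
      <= gap u kap (K / s ^+ 2) q (A / (2 * s ^+ 2)) y x'].
Proof.
move=> s0 Ks rs u0 su hx0 ux0 hy.
have [x [near ux Dx hx]] := touch_near s0 Ks u0 hx0 ux0 hy.
exists x; split => //; rewrite ltNge; apply/negP => far.
have n1 : 1 <= n by rewrite ler1n.
have L1 := Lambda_ge1; have K1 := K_ge1; have e0 := eta_gt0.
have A0 := A_gt0; have kap0 := kap_ge0; have Kl := K_large.
have c10 := mesh_frac_gt0 R N0; have b0 := beta_gt0.
have ss : 0 < s ^+ 2 by rewrite exprn_gt0.
set k := K / s ^+ 2 in Ks hx *; set A' := A / (2 * s ^+ 2) in hx *.
set eta := eta1 / s ^+ 2 in hx *.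
have k0 : 0 <= k by apply: divr_ge0; lra.
have ks : k * s ^+ 2 = K by rewrite /k divfK// gt_eqF.
have A's : A' * s ^+ 2 = A / 2 by rewrite /A'; field; rewrite gt_eqF.
have A'0 : 0 <= A' by apply: divr_ge0; lra.
have es : eta * s ^+ 2 = eta1 by rewrite /eta divfK// gt_eqF.
pose X := x - q.
have X0 : X != 0.
  apply/eqP => X0; move: far; rewrite -/X X0 /sq big1 ?leNgt ?divr_gt0//.
  by move=> i _; rewrite mxE expr0n.
pose P := kap * gauss k q x.
have P0 : 0 <= P by rewrite mulr_ge0// expR_ge0.
have Plow : kap * expR (- (16 * n * K)) <= P.
  apply: ler_wpM2l => //; rewrite ler_expR lerN2 -ks.
  by have := ler_wpM2l k0 (ltW near); lra.
have kX : K / 16 <= k * sq X by rewrite -ks; have := ler_wpM2l k0 far; rewrite -/X; lra.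
(* The box lies in the direction of [X]. There (7/16)^2 |X|^2 bounds the squared products from below
   and k|X|^2 is at least K/16, so the surplus is (49/8192) P k K; the 200 in [K_large] is a number
   above 8192/49. *)
have H := @contact_bound R N Lambda alpha beta N0 Lambda_ge1 beta_gt0 ab1 rho u kap k q A' y x eta
  ((2 * enorm X)^-1 *: X) (P * k * (K / 16) * (49 / 512)) (su x Dx) kap0 k0 Ks A'0.
have htau z : box ((2 * enorm X)^-1 *: X) a z ->
    P * k * (K / 16) * (49 / 512) <= P * (k ^+ 2 * dot X z ^+ 2 / 2) +
      (gap u kap k q A' y (x + z) - gap u kap k q A' y x + eta).
  move=> hz.
  have d0 := dot_box_ge N0 X0 hz.
  have d2 : 49 / 256 * sq X <= dot X z ^+ 2.
    by rewrite -enorm_sq; have := enorm_ge0 X; nra.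
  have zB := box_sub_eball0_dir N0 hz.
  have Bz : box x Lambda (x + z).
    move=> i; rewrite !mxE addrAC subrr add0r; apply: eball0_coord.
    exact: lt_le_trans zB L1.
  have := hx _ (box_near s0 near Bz).
  suff : P * k * (K / 16) * (49 / 512) <= P * (k ^+ 2 * dot X z ^+ 2 / 2) by lra.
  have -> : P * k * (K / 16) * (49 / 512) = (P * k) * (K / 16 * (49 / 512)) by ring.
  have -> : P * (k ^+ 2 * dot X z ^+ 2 / 2) = (P * k) * (k * dot X z ^+ 2 / 2) by ring.
  apply: ler_wpM2l; first exact: mulr_ge0.
  by have := ler_wpM2l k0 d2; lra.
have {htau}H := H (fun x' hx' => hx x' (box_near s0 near hx'))
  (box_sub_eball0_dir N0) htau; rewrite -/P in H.
have H1 : P * k <= 2 * rho + 2 * eta + 2 * Lambda ^+ 2 * A'.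
  have Pk : 0 <= P * k by exact: mulr_ge0.
  have : (P * k) * (2 * Lambda ^+ 2 + 1) <= (P * k) * (beta * c1 * K / 200).
    exact: ler_wpM2l.
  have : 0 <= P * k * (beta * c1 * K).
    apply: mulr_ge0 => //; apply: mulr_ge0; last by lra.
    by apply: mulr_ge0; exact: ltW.
  by lra.
have H2 : P * K <= 2 * (rho * s ^+ 2) + 2 * eta1 + Lambda ^+ 2 * A.
  have := ler_wpM2r (ltW ss) H1.
  rewrite -es (_ : A = 2 * (A' * s ^+ 2)); last by rewrite A's; field.
  by rewrite -[K in _ -> P * K <= _]ks; lra.
have Kg : g <= P * K.
  by rewrite /g mulrAC; apply: ler_wpM2r => //; lra.
have := A_g; have := eta_g; have := rho_g.
have g0 : 0 < g.
  have := kap_large; have : 0 < expR (- (16 * n * K)) := expR_gt0 _.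
  move=> E0 kl; have kp : 0 < kap.
    rewrite lt_neqAle kap0 andbT eq_sym; apply/eqP => kz.
    by move: kl; rewrite kz mul0r; lra.
  by rewrite /g !mulr_gt0//; lra.
by lra.
Qed.

(** The distance of the vertices, solved from the contact inequality multiplied by s^2. As all terms
    are of order s^-2, the result does not depend on s. *)
Definition sep : R :=
  4 * (2 * rho1 + (2 + beta * c1) * eta1 + 2 * Lambda ^+ 2 * (kap * K) + Lambda ^+ 2 * A)
    / (beta * c1 * A).

Lemma gap_vertex u k q A' y1 y2 x : gap u kap k q A' y1 x =
  gap u kap k q A' y2 x + A' * (2 * dot (y2 - y1) (x - y2) + sq (y2 - y1)).
Proof.
rewrite /gap (_ : x - y1 = (x - y2) + (y2 - y1)); last by rewrite addrA subrK.
by rewrite (sqD (x - y2)) (dotC (x - y2)); ring.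
Qed.

(* Two gaps differ by an affine function whose slope is proportional to the
   difference of the vertices; the average of the first gap over the unit ball
   around its contact point bounds that slope. *)
Lemma touch_sep rho u s q y1 y2 x1 x2 : 0 < s -> K / s ^+ 2 <= 1 / 2 ->
  rho * s ^+ 2 <= rho1 ->
  (forall x, box q (4 * n * s + Lambda) x -> supersol Lambda alpha beta rho u x) ->
  sq (x1 - q) < s ^+ 2 / 16 -> sq (x2 - q) < s ^+ 2 / 16 ->
  (forall x', box q (4 * n * s + Lambda) x' ->
      gap u kap (K / s ^+ 2) q (A / (2 * s ^+ 2)) y1 x1 - eta1 / s ^+ 2
      <= gap u kap (K / s ^+ 2) q (A / (2 * s ^+ 2)) y1 x') ->
  (forall x', box q (4 * n * s + Lambda) x' ->
      gap u kap (K / s ^+ 2) q (A / (2 * s ^+ 2)) y2 x2 - eta1 / s ^+ 2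
      <= gap u kap (K / s ^+ 2) q (A / (2 * s ^+ 2)) y2 x') ->
  (forall i, `|x1 0 i - x2 0 i| < 2 * a) -> enorm (y2 - y1) <= sep.
Proof.
move=> s0 Ks rs su near1 near2 h1 h2 x12.
have n1 : 1 <= n by rewrite ler1n.
have L1 := Lambda_ge1; have K1 := K_ge1; have e0 := eta_gt0; have r0 := rho_ge0.
have A0 := A_gt0; have kap0 := kap_ge0.
have c10 := mesh_frac_gt0 R N0; have b0 := beta_gt0.
have bc0 : 0 < beta * c1 by exact: mulr_gt0.
have L2 : 0 <= Lambda ^+ 2 by exact: sqr_ge0.
have KK : 0 <= kap * K by apply: mulr_ge0 => //; exact: le_trans K1.
have ss : 0 < s ^+ 2 by rewrite exprn_gt0.
have near16 x : sq (x - q) < s ^+ 2 / 16 -> sq (x - q) < 16 * n * s ^+ 2.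
  by move=> H; apply: lt_trans H _; nra.
have self x : sq (x - q) < s ^+ 2 / 16 -> box q (4 * n * s + Lambda) x.
  move=> H; apply: (box_near s0 (near16 _ H)) => i.
  by rewrite subrr normr0; exact: lt_le_trans L1.
set k := K / s ^+ 2 in Ks h1 h2; set A' := A / (2 * s ^+ 2) in h1 h2.
set eta := eta1 / s ^+ 2 in h1 h2.
have k0 : 0 <= k by apply: divr_ge0; [exact: le_trans K1|exact: ltW].
have ks : k * s ^+ 2 = K by rewrite /k divfK// gt_eqF.
have A's : A' * s ^+ 2 = A / 2 by rewrite /A'; field; rewrite gt_eqF.
have A'0 : 0 <= A' by apply: divr_ge0; [exact: ltW|rewrite mulr_ge0// ltW].
have es : eta * s ^+ 2 = eta1 by rewrite /eta divfK// gt_eqF.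
set v := y2 - y1.
have [->|v0] := eqVneq v 0.
  rewrite /enorm big1 ?sqrtr0; last by move=> i _; rewrite mxE expr0n.
  apply: divr_ge0; last by rewrite mulr_ge0// ltW.
  apply: mulr_ge0 => //; apply: addr_ge0; last by rewrite mulr_ge0// ltW.
  apply: addr_ge0; last by apply: mulr_ge0 => //; apply: mulr_ge0.
  apply: addr_ge0; first exact: mulr_ge0.
  by apply: mulr_ge0; [apply: addr_ge0 => //; exact: ltW|exact: ltW].
(* Moving from [x1] in the direction of [v]. The second gap is almost minimal at [x2] and the first
   at [x1], so only the affine difference remains: twice A' times <v,z> + <v,x1 - x2>, which is at
   least (7/16 - 2/16)|v| because both contact points lie within one cell size. *)
have htau z : box ((2 * enorm v)^-1 *: v) a z ->
    A' * enorm v / 2 - eta <= kap * gauss k q x1 * (k ^+ 2 * dot (x1 - q) z ^+ 2 / 2) +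
      (gap u kap k q A' y1 (x1 + z) - gap u kap k q A' y1 x1 + eta).
  move=> hz; have d0 := dot_box_ge N0 v0 hz.
  have zB := box_sub_eball0_dir N0 hz.
  have Bz : box x1 Lambda (x1 + z).
    move=> i; rewrite !mxE addrAC subrr add0r; apply: eball0_coord.
    exact: lt_le_trans zB L1.
  have h2z := h2 _ (box_near s0 (near16 _ near1) Bz).
  have h1x := h1 _ (self _ near2).
  have e1 := gap_vertex u k q A' y1 y2 (x1 + z).
  have e2 := gap_vertex u k q A' y1 y2 x2.
  rewrite -/v in e1 e2.
  have e3 : dot v (x1 + z - y2) - dot v (x2 - y2) = dot v z + dot v (x1 - x2).
    rewrite -dotN -!dotD; congr dot; apply/rowP => i; rewrite !mxE; ring.
  have := @dot_coord_le R N v (x1 - x2) (2 * a).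
  rewrite (_ : n * (2 * a) = 2 * (n * a)); last by ring.
  rewrite natr_mesh// ler_norml => /(_ _)H.
  have /andP[d1 _] : - (2 * 16^-1 * enorm v) <= dot v (x1 - x2) <= 2 * 16^-1 * enorm v.
    by apply: H => i; rewrite !mxE ltW.
  have P0 : 0 <= kap * gauss k q x1 * (k ^+ 2 * dot (x1 - q) z ^+ 2 / 2).
    apply: mulr_ge0; first by rewrite mulr_ge0// expR_ge0.
    by rewrite divr_ge0// mulr_ge0// sqr_ge0.
  have d3 : A' * (enorm v / 4) <= A' * (dot v (x1 + z - y2) - dot v (x2 - y2)).
    by apply: ler_wpM2l => //; rewrite e3; have := enorm_ge0 v; lra.
  by lra.
have := contact_bound N0 Lambda_ge1 beta_gt0 ab1 (su x1 (self _ near1)) kap0 k0 Ks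
  A'0 (fun x' hx' => h1 x' (box_near s0 (near16 _ near1) hx'))
  (box_sub_eball0_dir N0) htau.
set P := kap * gauss k q x1 => H.
have Pk : P <= kap by rewrite /P ler_piMr// gauss_le1.
have H1 : beta * c1 * (A * enorm v / 4 - eta1) <=
    2 * (rho * s ^+ 2) + 2 * eta1 + 2 * Lambda ^+ 2 * (kap * K) + Lambda ^+ 2 * A.
  have := ler_wpM2r (ltW ss) H.
  have -> : beta * c1 * (A' * enorm v / 2 - eta) * s ^+ 2 =
      beta * c1 * (A' * s ^+ 2 * enorm v / 2 - eta * s ^+ 2) by ring.
  have -> : (2 * rho + 2 * eta + 2 * Lambda ^+ 2 * (P * k + A')) * s ^+ 2 =
      2 * (rho * s ^+ 2) + 2 * (eta * s ^+ 2) + 2 * Lambda ^+ 2 *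
        (P * (k * s ^+ 2) + A' * s ^+ 2) by ring.
  rewrite A's es ks.
  have PK : P * K <= kap * K by apply: ler_wpM2r => //; exact: le_trans K1.
  have := ler_wpM2l L2 PK.
  by lra.
rewrite /sep ler_pdivlMr; last by rewrite mulr_gt0.
by lra.
Qed.

End touching.

(** * Counting cells of dyadic cubes *)

Section dyadic.
Context (R : realType) (N : nat) (h : R).
Hypothesis h_gt0 : 0 < h.
Implicit Types (p x : 'rV[R]_N) (s : R) (f g : 'rV[R]_N -> bool) (j : nat).

Definition cube p s : set 'rV[R]_N :=
  [set x | forall i, p 0 i <= x 0 i < p 0 i + s].

Definition child p s (b : {ffun 'I_N -> bool}) : 'rV[R]_N :=
  \row_i (p 0 i + (b i)%:R * s).

Definition side j : R := 2 ^+ j * h.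

(* The number of cells of side h in the dyadic cube of side 2^j h with corner
   p whose corner satisfies f. *)
Fixpoint ncells f j p : nat :=
  if j is j'.+1 then (\sum_b ncells f j' (child p (side j') b))%N else f p.

Lemma side_gt0 j : 0 < side j.
Proof. by rewrite mulr_gt0// exprn_gt0. Qed.

Lemma sideS j : side j.+1 = 2 * side j.
Proof. by rewrite /side exprS mulrA. Qed.

Lemma side0 : side 0 = h.
Proof. by rewrite /side expr0 mul1r. Qed.

Lemma child_sub p s b : 0 <= s -> cube (child p s b) s `<=` cube p (2 * s).
Proof.
move=> s0 x hx i; have /andP[] := hx i; rewrite !mxE.
by case: (b i) => /= ? ?; apply/andP; split; lra.
Qed.

Definition bits p s x : {ffun 'I_N -> bool} := [ffun i => p 0 i + s <= x 0 i].

Lemma child_bits p s x : cube p (2 * s) x -> cube (child p s (bits p s x)) s x.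
Proof.
move=> hx i; have /andP[? ?] := hx i; rewrite !mxE ffunE.
by have [H|H] := leP (p 0 i + s) (x 0 i); rewrite ?mul1r ?mul0r; apply/andP; split; lra.
Qed.

Lemma card_bits : #|{: {ffun 'I_N -> bool}}| = (2 ^ N)%N.
Proof. by rewrite card_ffun card_bool card_ord. Qed.

Lemma ncells_compl f j p : (ncells f j p + ncells (predC f) j p = 2 ^ (N * j))%N.
Proof.
elim: j p => [|j IH] p /=; first by rewrite muln0; case: (f p).
rewrite -big_split/=; under eq_bigr do rewrite IH.
by rewrite sum_nat_const card_bits -expnD mulnS.
Qed.

Lemma ncells_full f j p :
  (forall p', cube p' h `<=` cube p (side j) -> f p') ->
  ncells f j p = (2 ^ (N * j))%N.
Proof.
elim: j p => [|j IH] p hf /=; first by rewrite muln0 hf// side0.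
under eq_bigr => b _.
  rewrite IH; last first.
    move=> p' hp'; apply: hf; apply: subset_trans hp' _; rewrite sideS.
    by apply: child_sub; rewrite ltW// side_gt0.
  over.
by rewrite sum_nat_const card_bits -expnD mulnS.
Qed.

Lemma ncells_exists f j p : (0 < ncells f j p)%N ->
  exists2 p', cube p' h `<=` cube p (side j) & f p'.
Proof.
elim: j p => [|j IH] p /=.
  by rewrite lt0b => fp; exists p; rewrite ?side0.
rewrite lt0n sum_nat_eq0 negb_forall => /existsP[b].
rewrite -lt0n => /IH[p' hp' fp']; exists p' => //.
apply: subset_trans hp' _; rewrite sideS.
by apply: child_sub; rewrite ltW// side_gt0.
Qed.

Lemma ncells_le f g j p :
  (forall p', cube p' h `<=` cube p (side j) -> f p' -> g p') ->
  (ncells f j p <= ncells g j p)%N.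
Proof.
elim: j p => [|j IH] p hfg /=.
  by move: (hfg p); rewrite side0; case: (f p) => // ->.
apply: leq_sum => b _; apply: IH => p' hp'; apply: hfg.
apply: subset_trans hp' _; rewrite sideS.
by apply: child_sub; rewrite ltW// side_gt0.
Qed.

(** Sorting the indices by the child cube that contains their point reduces the claim to a single
    cell, where any two points differ by less than [h] in each coordinate and thus have the same
    index. *)
Lemma ncells_inj (T : finType) (Y : {set T}) (X : T -> 'rV[R]_N) f j p :
  (forall y, y \in Y -> cube p (side j) (X y)) ->
  (forall y y', y \in Y -> y' \in Y ->
     (forall i, `|X y 0 i - X y' 0 i| < h) -> y = y') ->
  (forall y p', y \in Y -> cube p' h (X y) -> f p') ->
  (#|Y| <= ncells f j p)%N.
Proof.
elim: j p Y => [|j IH] p Y hX inj hf /=.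
  have [->|[y yY]] := set_0Vmem Y; first by rewrite cards0.
  rewrite (hf y)//; last by rewrite -side0; exact: hX.
  rewrite /= -(cards1 y); apply/subset_leq_card/fintype.subsetP => y' y'Y.
  rewrite inE; apply/eqP; apply: inj => // i.
  have /andP[] := hX y yY i; have /andP[] := hX y' y'Y i; rewrite side0 ltr_norml.
  by move=> *; apply/andP; split; lra.
pose b y := bits p (side j) (X y).
have -> : #|Y| = (\sum_c #|[set y in Y | b y == c]|)%N.
  rewrite -sum1_card (partition_big b xpredT)//=; apply: eq_bigr => c _.
  by rewrite -sum1_card; apply: eq_bigl => y; rewrite inE.
apply: leq_sum => c _; apply: IH.
- move=> y; rewrite inE => /andP[yY /eqP <-]; apply: child_bits.
  by rewrite -sideS; exact: hX.
- by move=> y y'; rewrite !inE => /andP[yY _] /andP[y'Y _]; exact: inj.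
- by move=> y p'; rewrite inE => /andP[yY _]; exact: hf.
Qed.

(** A density condition kept in [nat]. At level 0, for positive [D], it reduces to [f p], which lets
    the decomposition end at the cells. *)
Definition mostly D f j p := (D * ncells (predC f) j p < 2 ^ (N * j))%N.

(* Calderon-Zygmund decomposition; as it stops at the cells, it is an induction
   on the level and needs no density theorem. *)
Lemma dyadic_growth (D : nat) f g j p :
  (forall i p' b, (i < j)%N -> cube p' (side i.+1) `<=` cube p (side j) ->
     mostly D f i (child p' (side i) b) ->
     forall c, cube c h `<=` cube p' (side i.+1) -> g c) ->
  ~~ mostly D f j p -> (D * ncells f j p <= D.-1 * ncells g j p)%N.
Proof.
have bound f' j' p' : ~~ mostly D f' j' p' ->
    (D * ncells f' j' p' <= D.-1 * 2 ^ (N * j'))%N.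
  rewrite /mostly -leqNgt -(ncells_compl f' j' p') => H.
  case: D H => [|D] H; first by rewrite mul0n.
  rewrite /= mulnDr -(leq_add2r (ncells f' j' p' + ncells (predC f') j' p')).
  by move: H; rewrite !mulSn; lia.
elim: j p => [|j IH] p Hg nd.
  move: nd; rewrite /mostly /= muln0 expn0 -leqNgt.
  by case: (f p) => /=; rewrite !muln0.
(* A child of high density puts its whole parent into [g], and then [bound] suffices for the parent.
   If there is none, the induction hypothesis applies to every child. *)
have [/existsP[b db]|] := boolP [exists b, mostly D f j (child p (side j) b)].
  rewrite (ncells_full (f := g)); first exact: bound.
  by move=> c hc; apply: (Hg j p b).
rewrite negb_exists => /forallP nb /=.
rewrite !big_distrr/=; apply: leq_sum => b _; apply: IH; last exact: nb.
move=> i p' b' ij sub; apply: Hg; first exact: ltnW; apply: subset_trans sub _; rewrite sideS.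
by apply: child_sub; rewrite ltW// side_gt0.
Qed.

End dyadic.

(** * From measure to pointwise bounds *)

Section growth.
Context (R : realType) (N : nat) (Lambda alpha beta : R).
Hypothesis N0 : (0 < N)%N.
Hypothesis Lambda_ge1 : 1 <= Lambda.
Hypothesis alpha_ge0 : 0 <= alpha.
Hypothesis beta_gt0 : 0 < beta.
Hypothesis ab1 : alpha + beta = 1.
Local Notation a := (mesh R N).
Local Notation h := (2 * mesh R N).
Local Notation c1 := (mesh_frac R N).
Local Notation n := (N%:R : R).

Implicit Types (x y z q p : 'rV[R]_N) (u : 'rV[R]_N -> R) (s rho : R).

Definition midpoint p s : 'rV[R]_N := \row_i (p 0 i + s / 2).

(** A statement about all points of a cell, made boolean so that cells can be counted. *)
Definition cell_ge u m p : bool := `[< forall x, cube p h x -> m <= u x >].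

Lemma cell_geP u m p : reflect (forall x, cube p h x -> m <= u x) (cell_ge u m p).
Proof. exact: asboolP. Qed.

Lemma h_gt0 : 0 < h.
Proof. by rewrite mulr_gt0// mesh_gt0. Qed.

Lemma cube_midpoint p s x : cube p s x -> forall i, `|(x - midpoint p s) 0 i| <= s / 2.
Proof.
move=> hx i; have /andP[? ?] := hx i; rewrite !mxE ler_norml.
by apply/andP; split; lra.
Qed.

Lemma box_sub_cube p s : box (midpoint p s) (s / 2) `<=` cube p s.
Proof.
move=> x hx i; have := hx i; rewrite mxE ltr_norml => /andP[? ?].
by apply/andP; split; lra.
Qed.

(* Slide paraboloids with vertices on a grid of step [side h i] in the cube: by
   [touch_sep] their contact points lie in distinct cells. *)
Lemma ncells_touching (K kap A eta1 rho1 M rho : R) u p x0 (i j : nat) :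
  1 <= K -> 2 * Lambda ^+ 2 + 1 <= beta * c1 * K / 200 -> 0 <= kap ->
  2 <= kap * (expR (- (4 * n * K)) - expR (- (16 * n * K))) ->
  0 < A -> A * (9 * n) <= 1 ->
  Lambda ^+ 2 * A <= kap * K * expR (- (16 * n * K)) / 4 ->
  0 < eta1 -> eta1 <= 1 / 4 -> eta1 <= kap * K * expR (- (16 * n * K)) / 16 ->
  0 <= rho1 -> rho1 <= kap * K * expR (- (16 * n * K)) / 16 ->
  (i <= j)%N -> sep N Lambda beta K kap A eta1 rho1 < side h i ->
  kap + 2 <= M ->
  let s := side h j in let q := midpoint p s in
  K / s ^+ 2 <= 1 / 2 -> rho * s ^+ 2 <= rho1 ->
  (forall x, box q (4 * n * s + Lambda) x -> 0 <= u x) ->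
  (forall x, box q (4 * n * s + Lambda) x -> supersol Lambda alpha beta rho u x) ->
  (forall i, `|(x0 - q) 0 i| <= 2 * s) -> u x0 < 1 ->
  (2 ^ (N * (j - i)) <= ncells h (predC (cell_ge u M)) j p)%N.
Proof.
move=> K1 K2 kap0 kap2 A0 A9 A4 e0 e4 e16 r0 r16 ij hsep kM s q Ks rs u0 su hx0 ux0.
have s0 : 0 < s by apply: side_gt0; exact: h_gt0.
have hi0 : 0 < side h i by apply: side_gt0; exact: h_gt0.
pose T := {ffun 'I_N -> 'I_(2 ^ (j - i))}.
pose y (f : T) : 'rV[R]_N := \row_l (p 0 l + side h i * (f l)%:R).
have sE : s = side h i * (2 ^ (j - i))%:R.
  rewrite /s /side mulrAC natrX -exprD subnKC//.
have hy f l : `|(y f - q) 0 l| <= s.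
  rewrite !mxE (_ : _ - _ = side h i * (f l)%:R - s / 2); last by ring.
  have f0 : 0 <= side h i * (f l)%:R by rewrite mulr_ge0// ltW.
  have fs : side h i * (f l)%:R <= s.
    by rewrite sE ler_pM2l// ler_nat ltnW.
  by rewrite ler_norml; apply/andP; split; lra.
have /choice[X hX] f := touch N0 Lambda_ge1 beta_gt0 ab1 K1 K2 kap0 kap2 A0 A9 A4
  e0 e4 e16 r16 s0 Ks rs u0 su hx0 ux0 (hy f).
have -> : (2 ^ (N * (j - i)))%N = #|[set: T]%SET|.
  by rewrite cardsT card_ffun !card_ord -expnM mulnC.
apply: (ncells_inj (X := X)).
- move=> f _; apply: box_sub_cube => l; rewrite -/s -/q.
  have [near _ _] := hX f.
  have H : `|(X f - q) 0 l| < s / 4.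
    apply: coord_lt_sq; first by rewrite divr_ge0// ltW.
    by apply: lt_le_trans near _; rewrite expr_div_n; lra.
  rewrite (_ : X f 0 l - q 0 l = (X f - q) 0 l); last by rewrite !mxE.
  by apply: lt_trans H _; lra.
- move=> f f' _ _ hff'; apply/ffunP => l; apply/eqP; apply/negPn/negP => fl.
  have [near1 _ m1] := hX f; have [near2 _ m2] := hX f'.
  have := touch_sep N0 Lambda_ge1 beta_gt0 ab1 K1 kap0 A0 e0 r0 s0 Ks rs su
    near1 near2 m1 m2 hff'.
  apply/negP; rewrite -ltNge; apply: lt_le_trans hsep _.
  apply: le_trans (coord_le_enorm _ l); rewrite !mxE.
  rewrite (_ : _ - _ = side h i * ((f' l)%:R - (f l)%:R)); last by ring.
  rewrite normrM gtr0_norm//; apply: ler_peMr; first exact: ltW.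
  have key (l1 l2 : nat) : (l1 < l2)%N -> 1 <= `|l2%:R - l1%:R| :> R.
    move=> H; have H' : l1%:R + 1 <= l2%:R :> R by rewrite natr1 ler_nat.
    by rewrite ler_normr; apply/orP; left; lra.
  rewrite neq_ltn in fl; case/orP: fl => /key H; first exact: H.
  by rewrite distrC; exact: H.
- move=> f p' _ hp'; apply/negP => /cell_geP/(_ _ hp').
  by have [_ + _] := hX f; lra.
Qed.

(** With a value below 1 nearby, [ncells_touching] finds at least 2^(N(j-i)) cells that fail, a
    fraction 1/D for D = 2^(Ni), which [mostly] excludes. For j below the fixed level i, [mostly]
    leaves no failing cell and [spread] bridges the bounded distance. The conclusion reaches to
    [2 * s] from the midpoint so as to cover the parent cube, as the decomposition demands. *)
Lemma growth_step : exists (D : nat) (M rho1 Kg : R),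
  [/\ (1 < D)%N, 1 <= M, 0 < rho1, 0 < Kg &
  forall (j : nat) p u rho, 0 <= rho ->
    let s := side h j in let q := midpoint p s in
    rho * s ^+ 2 <= rho1 ->
    (forall x, box q (Kg * s) x -> 0 <= u x) ->
    (forall x, box q (Kg * s) x -> supersol Lambda alpha beta rho u x) ->
    mostly h D (cell_ge u M) j p ->
    forall x, (forall i, `|(x - q) 0 i| <= 2 * s) -> 1 <= u x].
Proof.
have n1 : 1 <= n by rewrite ler1n.
have L1 := Lambda_ge1; have b0 := beta_gt0.
have c10 := mesh_frac_gt0 R N0; have h0 := h_gt0; have a0 := mesh_gt0 R N0.
have bc0 : 0 < beta * c1 by exact: mulr_gt0.
have L2 : 0 < Lambda ^+ 2 by rewrite exprn_gt0//; lra.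
pose K := 1 + 200 * (2 * Lambda ^+ 2 + 1) / (beta * c1).
have K1 : 1 <= K by rewrite lerDl divr_ge0 ?(ltW bc0)//; lra.
have K2 : 2 * Lambda ^+ 2 + 1 <= beta * c1 * K / 200.
  have -> : beta * c1 * K / 200 = beta * c1 / 200 + (2 * Lambda ^+ 2 + 1).
    by rewrite /K; field; rewrite !gt_eqF.
  by rewrite lerDr; lra.
pose E4 := expR (- (4 * n * K)); pose E16 := expR (- (16 * n * K)).
have E160 : 0 < E16 by exact: expR_gt0.
have E416 : 0 < E4 - E16 by rewrite subr_gt0 ltr_expR; nra.
pose kap := 2 / (E4 - E16).
have kap0 : 0 < kap by apply: divr_gt0; lra.
have kap2 : 2 <= kap * (E4 - E16) by rewrite /kap divfK ?gt_eqF.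
pose g := kap * K * E16.
have K0 : 0 < K by exact: lt_le_trans K1.
have g0 : 0 < g by apply: mulr_gt0 => //; exact: mulr_gt0.
pose A := Num.min (9 * n)^-1 (g / (4 * Lambda ^+ 2)).
have A0 : 0 < A.
  by rewrite lt_min; apply/andP; split; [rewrite invr_gt0|apply: divr_gt0 => //]; lra.
have A9 : A * (9 * n) <= 1.
  have n9 : 0 < 9 * n by lra.
  by rewrite -ler_pdivlMr// div1r ge_min lexx.
have A4 : Lambda ^+ 2 * A <= g / 4.
  rewrite mulrC -ler_pdivlMr// (_ : g / 4 / Lambda ^+ 2 = g / (4 * Lambda ^+ 2)); last first.
    by field; rewrite gt_eqF//; lra.
  by rewrite ge_min lexx orbT.
pose eta1 := Num.min (1 / 4) (g / 16).
have e0 : 0 < eta1 by rewrite lt_min; apply/andP; split; lra.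
have e4 : eta1 <= 1 / 4 by rewrite ge_min lexx.
have e16 : eta1 <= g / 16 by rewrite ge_min lexx orbT.
(* As [s] is at least [h], the bound [h ^+ 2] gives [rho <= 1], so the loss in [spread] is at most
   2. *)
pose rho1 := Num.min (g / 16) (h ^+ 2).
have r0 : 0 < rho1 by rewrite lt_min [0 < h ^+ 2]exprn_gt0// andbT; lra.
have r16 : rho1 <= g / 16 by rewrite ge_min lexx.
have rh : rho1 <= h ^+ 2 by rewrite ge_min lexx orbT.
pose X := `|sep N Lambda beta K kap A eta1 rho1| + 2 * K.
pose i := (Num.bound (X / h)).+1.
have hX : X < side h i.
  by rewrite /side -ltr_pdivrMr//; apply: upper_nthrootP.
have hsep : sep N Lambda beta K kap A eta1 rho1 < side h i.
  apply: le_lt_trans (ler_norm _) (le_lt_trans _ hX).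
  by rewrite lerDl; lra.
have hK : 2 * K <= side h i by rewrite ltW// (le_lt_trans _ hX)// lerDr.
pose S0 := side h i.
(* Enough steps for the distance 3 S0: the target is within 2s of the midpoint of the cube, the
   starting cell within s/2, and s is at most S0. *)
pose k := Num.bound (3 * S0 / a).
have kS : 3 * S0 < k.+1%:R * a.
  rewrite -ltr_pdivrMr//; apply: lt_trans (archi_boundP _) _.
    by rewrite divr_ge0 ?(ltW a0)// mulr_ge0// ltW// side_gt0.
  by rewrite ltr_nat.
pose th := (beta * c1 / 2) ^+ k.
have th0 : 0 < th by rewrite exprn_gt0// divr_gt0.
(* [kap + 2] bounds [u] at contact points; [3 / th] leaves 3 after the [k] steps of [spread], hence
   1 after its error. *)
pose M := kap + 2 + 3 / th.
have M3 : 3 <= th * M.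
  rewrite (_ : th * M = 3 + th * (kap + 2)); last first.
    by rewrite /M; field; rewrite gt_eqF.
  by rewrite lerDl mulr_ge0 ?(ltW th0)//; lra.
have tM0 : 0 <= 3 / th by rewrite divr_ge0// ltW.
pose Kg := 4 * n + 1 + (k.+1%:R * a + Lambda) / h.
have ka0 : 0 <= k.+1%:R * a by rewrite mulr_ge0// ltW.
have Kh : (k.+1%:R * a + Lambda) / h * h = k.+1%:R * a + Lambda by rewrite divfK ?gt_eqF.
have Kq0 : 0 <= (k.+1%:R * a + Lambda) / h by rewrite divr_ge0 ?(ltW h0)//; lra.
exists (2 ^ (N * i))%N, M, rho1, Kg; split => //.
- by rewrite -[X in (X < _)%N](expn0 2) ltn_exp2l// muln_gt0 N0.
- by rewrite /M; lra.
- by rewrite /Kg; lra.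
move=> j p u rho rho0 s q rs u0 su dn x hx.
have s0 : 0 < s by exact: side_gt0.
have hs : h <= s.
  by rewrite /s /side ler_peMl ?(ltW h0)// exprn_ege1// ler1n.
have Kgs : 4 * n * s + s + (k.+1%:R * a + Lambda) <= Kg * s.
  have H := ler_wpM2l Kq0 hs; rewrite Kh in H.
  by apply: le_trans (lerD (lexx _) H) _; rewrite le_eqVlt; apply/orP; left; apply/eqP; rewrite /Kg; ring.
have [ij|ji] := leqP i j.
  rewrite leNgt; apply/negP => ux.
  have DS (r : R) : r <= 4 * n * s + Lambda -> box q r `<=` box q (Kg * s).
    by move=> hr y hy l; apply: lt_le_trans (hy l) _; lra.
  have Ss : S0 <= s.
    by rewrite /S0 /s /side ler_pM2r// ler_weXn2l// ler1n.
  have Ks : K / s ^+ 2 <= 1 / 2.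
    by rewrite ler_pdivrMr ?exprn_gt0// -/S0 in hK *; nra.
  have := @ncells_touching K kap A eta1 rho1 M rho u p x i j K1 K2 (ltW kap0) kap2
    A0 A9 A4 e0 e4 e16 (ltW r0) r16 ij hsep.
  rewrite -/s -/q => /(_ _ Ks rs _ _ hx ux) H.
  have {H} : (2 ^ (N * (j - i)) <= ncells h (predC (cell_ge u M)) j p)%N.
    apply: H; first by rewrite /M; lra.
    - by move=> y /(DS _ (lexx _)); exact: u0.
    - by move=> y /(DS _ (lexx _)); exact: su.
  move: dn; rewrite /mostly => dn H.
  have := leq_ltn_trans (leq_mul (leqnn (2 ^ (N * i))%N) H) dn.
  by rewrite -expnD -mulnDr subnKC// ltnn.
have [p' hp' /cell_geP fp'] : exists2 p', cube p' h `<=` cube p s & cell_ge u M p'.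
  apply: ncells_exists => //.
  have bad0 : ncells h (predC (cell_ge u M)) j p = 0%N.
    apply/eqP; rewrite -leqn0 leqNgt; apply/negP => b0'.
    move: dn; rewrite /mostly ltnNge; apply/negP/negPn.
    apply: leq_trans (leq_pmulr _ b0').
    by rewrite leq_exp2l// leq_mul2l (ltnW ji) orbT.
  by have := ncells_compl h (cell_ge u M) j p; rewrite bad0 addn0 => ->; rewrite expn_gt0.
pose c := midpoint p' h.
have ce : h / 2 = a by field.
have cq l : `|(c - q) 0 l| <= s / 2.
  apply: cube_midpoint; apply: hp'; apply: box_sub_cube => l'.
  by rewrite subrr normr0 ce.
have sS : s <= S0.
  by rewrite /S0 /s /side ler_pM2r// ler_weXn2l// ?ler1n// ltnW.
have DD y : box c (k.+1%:R * a + Lambda) y -> box q (Kg * s) y.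
  move=> hy l.
  have -> : y 0 l - q 0 l = (y 0 l - c 0 l) + (c - q) 0 l by rewrite [(c - q) _ _]mxE [(- q) _ _]mxE; ring.
  apply: le_lt_trans (ler_normD _ _) _; have := hy l; have := cq l.
  have : 0 <= n * s by rewrite mulr_ge0// ltW.
  by lra.
have Mc y : box c a y -> M <= u y.
  by move=> hy; apply: fp'; apply: box_sub_cube; rewrite ce.
have hxc : box c (k.+1%:R * a) x.
  move=> l.
  have -> : x 0 l - c 0 l = (x - q) 0 l - (c - q) 0 l by rewrite !mxE; ring.
  apply: le_lt_trans (ler_normB _ _) _; have := hx l; have := cq l.
  by lra.
have := spread N0 Lambda_ge1 alpha_ge0 beta_gt0 ab1 rho0 (fun y hy => u0 y (DD y hy))
  (fun y hy => su y (DD y hy)) (lexx _) Mc hxc.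
rewrite -/th; apply: le_trans.
have : rho <= 1.
  have : rho * h ^+ 2 <= h ^+ 2.
    apply: le_trans rh; apply: le_trans rs; apply: ler_wpM2l => //.
    by rewrite ler_pXn2r// nnegrE ltW.
  by rewrite ger_pMl// exprn_gt0.
by lra.
Qed.

End growth.

(** * Iterating the growth step over level sets *)

Lemma bernoulli_expn (m k : nat) : (m ^ k.+1 + k.+1 * m ^ k <= m.+1 ^ k.+1)%N.
Proof.
elim: k => [|k IH]; first by rewrite !expn1 expn0; lia.
rewrite [in X in (_ <= X)%N]expnS; apply: (@leq_trans (m.+1 * (m ^ k.+1 + k.+1 * m ^ k))).
  by rewrite !expnS; nia.
by rewrite leq_mul2l IH orbT.
Qed.

(** With D = m + 1 this is (1 - 1/D)^D < 1/2 in integers: a count that grows by D/(D - 1) in each of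
    D steps more than doubles. *)
Lemma double_expn_lt (m : nat) : (0 < m)%N -> (2 * m ^ m.+1 < m.+1 ^ m.+1)%N.
Proof.
move=> m0; apply: leq_trans (bernoulli_expn m m).
have : (0 < m ^ m)%N by rewrite expn_gt0 m0.
by rewrite !expnS; nia.
Qed.

Section measure_to_pointwise.
Context (R : realType) (N : nat) (Lambda alpha beta : R).
Hypothesis N0 : (0 < N)%N.
Hypothesis Lambda_ge1 : 1 <= Lambda.
Hypothesis alpha_ge0 : 0 <= alpha.
Hypothesis beta_gt0 : 0 < beta.
Hypothesis ab1 : alpha + beta = 1.
Local Notation h := (2 * mesh R N).
Implicit Types (x y z q p : 'rV[R]_N) (u : 'rV[R]_N -> R) (s rho : R).

Lemma supersol_scale rho u x (c : R) : 0 < c ->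
  supersol Lambda alpha beta rho u x ->
  supersol Lambda alpha beta (c * rho) (fun y => c * u y) x.
Proof.
move=> c0 su b b' t S mS SB hb hb' ht.
have dE y : delta2 (fun y => c * u y) x y = c * delta2 u x y by rewrite /delta2; ring.
have := su (b / c) (b' / c) (t / c) S mS SB.
have h1 z : eball 0 Lambda z -> b / c <= delta2 u x z.
  by move=> /hb; rewrite dE ler_pdivrMr// mulrC.
have h2 z : eball 0 1 z -> b' / c <= delta2 u x z.
  by move=> /hb'; rewrite dE ler_pdivrMr// mulrC.
have h3 z : S z -> b' / c + t / c <= delta2 u x z.
  by move=> /ht; rewrite dE -mulrDl ler_pdivrMr// mulrC.
move=> /(_ h1 h2 h3).
rewrite (_ : alpha * (b / c) + beta * (b' / c + t / c * vfrac S) =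
  (alpha * b + beta * (b' + t * vfrac S)) / c); last by ring.
by rewrite ler_pdivrMr//; lra.
Qed.

(** If the whole cube is [mostly] above M^-k for some k up to D, [growth_step] on that cube
    concludes. Otherwise [dyadic_growth] multiplies the number of cells above M^-k by at least D/(D
    - 1) whenever k increases by one; D steps more than double a count that was already half of all
    cells. *)
Lemma measure_to_pointwise : exists c0 rho0 Kg : R,
  [/\ 0 < c0, 0 < rho0, 0 < Kg &
  forall (j : nat) p u rho, 0 <= rho ->
    let s := side h j in let q := midpoint p s in
    rho * s ^+ 2 <= rho0 ->
    (forall x, box q (Kg * s) x -> 0 <= u x) ->
    (forall x, box q (Kg * s) x -> supersol Lambda alpha beta rho u x) ->
    (2 ^ (N * j) <= 2 * ncells h (cell_ge u 1%R) j p)%N ->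
    forall x, cube p s x -> c0 <= u x].
Proof.
have [D [M [rho1 [Kg [D1 M1 r0 Kg0 G]]]]] :=
  growth_step N0 Lambda_ge1 alpha_ge0 beta_gt0 ab1.
have M0 : 0 < M by exact: lt_le_trans M1.
have h0 := h_gt0 R N0.
exists (M ^- D.+1), (rho1 / M ^+ D.+1), (Kg + 1); split.
- by rewrite invr_gt0 exprn_gt0.
- by rewrite divr_gt0// exprn_gt0.
- by rewrite addr_gt0.
move=> j p u rho rho0 s q rs u0 su half x hx.
have s0 : 0 < s by exact: side_gt0.
have MD : 0 < M ^+ D.+1 by rewrite exprn_gt0.
(* [growth_step] for the multiple M^(k+1) u: its threshold M reads M^-k for u. Dividing [rho1] by
   M^(D+1) admits all these multiples, and [Kg + 1] makes room for subcubes off the centre. *)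
have step (i k : nat) p' : (i <= j)%N -> (k <= D)%N ->
    (forall l, `|(midpoint p' (side h i) - q) 0 l| <= s / 2) ->
    mostly h D (cell_ge u (M ^- k)) i p' ->
    forall y, (forall l, `|(y - midpoint p' (side h i)) 0 l| <= 2 * side h i) ->
    M ^- k.+1 <= u y.
  move=> ij kD hc dn y hy.
  have Mk : 0 < M ^+ k.+1 by rewrite exprn_gt0.
  have si0 : 0 < side h i by exact: side_gt0.
  have sij : side h i <= s.
    by rewrite /s /side ler_pM2r// ler_weXn2l// ler1n.
  have sub y' : box (midpoint p' (side h i)) (Kg * side h i) y' -> box q ((Kg + 1) * s) y'.
    move=> hy' l.
    have -> : y' 0 l - q 0 l = (y' 0 l - midpoint p' (side h i) 0 l) +
      (midpoint p' (side h i) - q) 0 l.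
      by rewrite [(midpoint _ _ - q) _ _]mxE [(- q) _ _]mxE; ring.
    apply: le_lt_trans (ler_normD _ _) _; have := hy' l; have := hc l.
    have : Kg * side h i <= Kg * s by rewrite ler_pM2l.
    by lra.
  have := G i p' (fun y => M ^+ k.+1 * u y) (M ^+ k.+1 * rho).
  rewrite /= => /(_ _ _ _ _ _ y hy) H.
  rewrite -[leLHS]mul1r ler_pdivrMr// mulrC; apply: H.
  - by rewrite mulr_ge0// ltW.
  - have h1 : rho * M ^+ D.+1 * s ^+ 2 <= rho1.
      by move: rs; rewrite ler_pdivlMr// mulrAC.
    apply: le_trans h1; rewrite [M ^+ _ * _]mulrC; apply: ler_pM.
    + by rewrite mulr_ge0// ltW.
    + exact: sqr_ge0.
    + by rewrite ler_wpM2l// ler_weXn2l.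
    + by rewrite ler_pXn2r// nnegrE ltW.
  - by move=> y' /sub/u0 H; rewrite mulr_ge0// ltW.
  - by move=> y' /sub/su H; exact: supersol_scale.
  - move: dn; rewrite /mostly; set f1 := predC _; set f2 := predC _.
    suff -> : f1 = f2 by [].
    rewrite /f1 /f2; congr predC; apply/funext => z; apply: asbool_equiv_eq.
    have e y' : (M <= M ^+ k.+1 * u y') = (M ^- k <= u y').
      by rewrite exprS -mulrA -[leLHS]mulr1 ler_pM2l// -ler_pdivrMl ?exprn_gt0// mulr1.
    by split => H y' /H; rewrite e.
have hcx : forall l, `|(midpoint p s - q) 0 l| <= s / 2.
  by move=> l; rewrite !mxE subrr normr0 divr_ge0// ltW.
have [/existsP[k dk]|none] := boolP [exists k : 'I_D.+1, mostly h D (cell_ge u (M ^- k)) j p].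
  have kD : (k <= D)%N by rewrite -ltnS.
  apply: le_trans (step j k p (leqnn j) kD hcx dk x _); last first.
    by move=> l; have := cube_midpoint hx l; rewrite -/s; lra.
  by rewrite lef_pV2 ?posrE ?exprn_gt0// ler_weXn2l.
exfalso; pose A k := ncells h (cell_ge u (M ^- k)) j p.
have grow k : (k <= D)%N -> (D * A k <= D.-1 * A k.+1)%N.
  move=> kD; apply: dyadic_growth => //; last first.
    by move: none; rewrite negb_exists => /forallP/(_ (Ordinal (kD : (k < D.+1)%N))).
  move=> i p' b ij sub dn c hc; apply/cell_geP => y /hc hy.
  apply: (step i k (child p' (side h i) b)) => //; first exact: ltnW.
    apply: cube_midpoint; apply: sub; rewrite sideS.
    apply: (@child_sub _ _ p' (side h i) b); first by rewrite ltW// side_gt0.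
    apply: box_sub_cube => l; rewrite subrr normr0 divr_gt0// side_gt0//.
  have si0 : 0 < side h i by exact: side_gt0.
  move=> l; have /andP[] := hy l; rewrite !mxE sideS ler_norml.
  by case: (b l) => /= ? ?; apply/andP; split; lra.
have iter k : (k <= D.+1)%N -> (D ^ k * A 0%N <= D.-1 ^ k * A k)%N.
  elim: k => [|k IH] kD; first by rewrite !expn0.
  rewrite !expnS -mulnA; apply: leq_trans (leq_mul (leqnn D) (IH (ltnW kD))) _.
  rewrite mulnCA -[X in (_ <= X)%N]mulnA [X in (_ <= X)%N]mulnCA leq_mul2l.
  by rewrite grow ?orbT.
have A0E : A 0%N = ncells h (cell_ge u 1%R) j p by rewrite /A expr0 invr1.
have := iter D (leqnSn D); rewrite -A0E in half.
have Ale : (A D <= 2 ^ (N * j))%N.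
  by rewrite -(ncells_compl h (cell_ge u (M ^- D)) j p) leq_addr.
have A0p : (0 < A 0%N)%N.
  by rewrite lt0n; apply/eqP => A00; move: half; rewrite A00 muln0 leqn0 expn_eq0.
have D0 : D = D.-1.+1 by rewrite prednK// ltnW.
have := @double_expn_lt D.-1; rewrite -D0 => /(_ _) H1 H2.
have {}H1 : (2 * D.-1 ^ D < D ^ D)%N by apply: H1; rewrite -ltnS -D0.
have : (D ^ D * A 0%N <= D.-1 ^ D * (2 * A 0%N))%N.
  by apply: leq_trans H2 _; rewrite leq_mul2l (leq_trans Ale half) orbT.
rewrite mulnA [(_ * 2)%N]mulnC leq_pmul2r//.
by rewrite leqNgt H1.
Qed.

End measure_to_pointwise.

(** * Oscillation decay *)

Lemma leq_double_compl (A B F P : nat) :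
  (2 * A < P)%N -> (F <= B)%N -> (A + F = P)%N -> (P <= 2 * B)%N.
Proof. by lia. Qed.

Section oscillation.
Context (R : realType) (N : nat) (Lambda alpha beta : R).
Hypothesis N0 : (0 < N)%N.
Hypothesis Lambda_ge1 : 1 <= Lambda.
Hypothesis alpha_ge0 : 0 <= alpha.
Hypothesis beta_gt0 : 0 < beta.
Hypothesis ab1 : alpha + beta = 1.
Local Notation a := (mesh R N).
Local Notation h := (2 * mesh R N).
Local Notation c1 := (mesh_frac R N).
Implicit Types (x y z q p : 'rV[R]_N) (u v : 'rV[R]_N -> R) (s rho : R).

Lemma supersol_addr rho v x (k : R) : supersol Lambda alpha beta rho v x ->
  supersol Lambda alpha beta rho (fun y => v y + k) x.
Proof.
have dE y : delta2 (fun y => v y + k) x y = delta2 v x y.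
  by rewrite /delta2; ring.
move=> sv b b' t S mS SB hb hb' ht; apply: sv => // y hy.
- by rewrite -dE; exact: hb.
- by rewrite -dE; exact: hb'.
- by rewrite -dE; exact: ht.
Qed.

(* By translation invariance, whichever of [E] and its complement fills half of
   the cell is seen with the same mass from every point of the cell. *)
Lemma cell_dichotomy rho v w p (omega : R) (E : set (borel_rV R N)) :
  measurable E -> 0 <= omega ->
  (forall y, cube p h y -> supersol Lambda alpha beta rho v y) ->
  (forall y, cube p h y -> supersol Lambda alpha beta rho w y) ->
  (forall x y, cube p h x -> box x Lambda y -> 0 <= v y) ->
  (forall x y, cube p h x -> box x Lambda y -> 0 <= w y) ->
  (forall y, E y -> omega <= v y) -> (forall y, ~ E y -> omega <= w y) ->
  cell_ge v (beta * c1 / 4 * omega - rho) p \/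
  cell_ge w (beta * c1 / 4 * omega - rho) p.
Proof.
move=> mE om0 sv sw v0 w0 Ev Ew; have a0 := mesh_gt0 R N0.
pose B := box (midpoint p h) a.
have mB : measurable (B : set (borel_rV R N)) by exact: measurable_box.
have key f (F : set (borel_rV R N)) : measurable F ->
    (forall y, cube p h y -> supersol Lambda alpha beta rho f y) ->
    (forall x y, cube p h x -> box x Lambda y -> 0 <= f y) ->
    (forall y, F y -> omega <= f y) -> F `<=` B -> c1 / 2 <= vfrac F ->
    cell_ge f (beta * c1 / 4 * omega - rho) p.
  move=> mF sf f0 Ff FB Fc; apply/cell_geP => x hx.
  have mS : measurable ([set y | F (x + y)] : set (borel_rV R N)).
    rewrite -[X in measurable X]setTI.
    have := measurable_affine_rV x 1 measurableT mF.
    by rewrite !setTI; congr measurable; apply/seteqP; split => y /=; rewrite scale1r.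
  have SB : [set y | F (x + y)] `<=` eball 0 1.
    apply: subset_trans (@box_mesh_sub_eball0 _ _ N0 (midpoint p h - x) _).
      move=> y /FB hy l; have := hy l; rewrite !mxE; congr (`|_| < _); ring.
    move=> l; have /andP[] := hx l; rewrite !mxE ler_norml => *.
    by apply/andP; split; lra.
  have := supersol_nonneg_lower Lambda_ge1 ab1 (sf x hx) (f0 x ^~ hx) mS SB
    (fun y Fy => Ff _ Fy).
  rewrite vfrac_translate//; apply: le_trans; rewrite lerD2r.
  have : 0 <= beta / 2 * (omega * (vfrac F - c1 / 2)).
    by rewrite mulr_ge0 ?divr_ge0 ?(ltW beta_gt0)// mulr_ge0// subr_ge0.
  by lra.
have split_B := vfrac_split mE mB a0 (@subset_refl _ _).
rewrite vfrac_box_mesh// in split_B.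
have [h1|h1] := leP (c1 / 2) (vfrac (B `&` E)).
  left; apply: (key v (B `&` E)) => //; first exact: measurableI.
  by move=> y [_]; exact: Ev.
right; apply: (key w (B `\` E)) => //; first exact: measurableD.
- by move=> y [_]; exact: Ew.
- by lra.
Qed.

Lemma osc_decay : exists c C Kd : R, [/\ 0 < c, c < 1, 0 < C, 0 < Kd &
  forall (j : nat) x u rho omega, 0 <= rho ->
    let s := side h j in
    measurable_fun setT (u : borel_rV R N -> R) ->
    (forall y, box x (Kd * s) y -> supersol Lambda alpha beta rho u y) ->
    (forall y, box x (Kd * s) y ->
       supersol Lambda alpha beta rho (fun y => - u y) y) ->
    (forall y1 y2, box x (Kd * s) y1 -> box x (Kd * s) y2 -> u y1 - u y2 <= omega) ->
    forall y1 y2, box x (s / 2) y1 -> box x (s / 2) y2 ->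
      u y1 - u y2 <= (1 - c) * omega + C * (rho * s ^+ 2)].
Proof.
have [c0 [rho0 [Kg [c00 r00 Kg0 G]]]] :=
  measure_to_pointwise N0 Lambda_ge1 alpha_ge0 beta_gt0 ab1.
have h0 := h_gt0 R N0; have a0 := mesh_gt0 R N0; have L1 := Lambda_ge1.
have bc0 : 0 < beta * c1 by rewrite mulr_gt0// mesh_frac_gt0.
(* The dichotomy at height omega/2 yields [2 * th * omega - rho], which is at least [th * omega] as
   soon as [rho <= th * omega]. *)
pose th := beta * c1 / 16.
have th0 : 0 < th by rewrite divr_gt0.
pose c := Num.min (1 / 2) (c0 * th).
(* If C rho s^2 exceeds omega the claim is trivial. Otherwise the first summand gives [rho <= t] and
   the second [rho / t * s ^+ 2 <= rho0], as needed after dividing by [t]. *)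
pose C := (h ^+ 2)^-1 / th + rho0^-1 / th.
pose Kd := Kg + 1 + Lambda / h.
have Lh : 0 < Lambda / h by rewrite divr_gt0//; lra.
have c_gt0 : 0 < c.
  by rewrite lt_min; apply/andP; split; [lra|exact: mulr_gt0].
exists c, C, Kd; split => //.
- by rewrite gt_min; apply/orP; left; lra.
- by rewrite addr_gt0// divr_gt0// invr_gt0// exprn_gt0.
- by rewrite !addr_gt0.
move=> j x u rho omega rho_ge0 s mu su sNu osc y1 y2 hy1 hy2.
have s0 : 0 < s by exact: side_gt0.
have hs : h <= s.
  by rewrite /s /side ler_peMl ?(ltW h0)// exprn_ege1// ler1n.
have Kds : Kg * s + s + Lambda <= Kd * s.
  have : Lambda / h * h <= Lambda / h * s by apply: ler_wpM2l => //; exact: ltW.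
  by rewrite divfK ?gt_eqF// /Kd; lra.
have Kgs : 0 < Kg * s by exact: mulr_gt0.
have DS r : r <= Kd * s -> box x r `<=` box x (Kd * s).
  by move=> rK y hy l; exact: lt_le_trans (hy l) rK.
have D1 : box x (Kd * s) y1 by apply: DS hy1; lra.
have D2 : box x (Kd * s) y2 by apply: DS hy2; lra.
have om0 : 0 <= omega by have := osc _ _ D1 D1; rewrite subrr.
have c_half : c <= 1 / 2 by rewrite ge_min lexx.
have c_th : c <= c0 * th by rewrite ge_min lexx orbT.
have [small|large] := leP (C * (rho * s ^+ 2)) omega; last first.
  have := osc _ _ D1 D2; have : 0 <= (1 - c) * omega by rewrite mulr_ge0//; lra.
  by lra.
have [om|om_gt0] := leP omega 0.
  have := osc _ _ D1 D2; have : c * omega <= 0 by rewrite pmulr_rle0.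
  have : 0 <= C * (rho * s ^+ 2).
    by rewrite mulr_ge0 ?mulr_ge0 ?sqr_ge0// ltW// addr_gt0// divr_gt0// invr_gt0// exprn_gt0.
  by lra.
have ss : 0 < s ^+ 2 by rewrite exprn_gt0.
have rs0 : 0 <= rho * s ^+ 2 by rewrite mulr_ge0// ltW.
pose t := th * omega.
have t0 : 0 < t by rewrite mulr_gt0.
have h2 : 0 < h ^+ 2 by rewrite exprn_gt0.
have smallt : (h ^+ 2)^-1 * (rho * s ^+ 2) + rho0^-1 * (rho * s ^+ 2) <= t.
  move: small; rewrite /C /t -mulrDl mulrAC ler_pdivrMr// -mulrDl.
  by rewrite [omega * _]mulrC.
have rt : rho <= t.
  apply: le_trans smallt; apply: (@le_trans _ _ ((h ^+ 2)^-1 * (rho * s ^+ 2))).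
    rewrite mulrC ler_pdivlMr// ler_wpM2l// ler_pXn2r// nnegrE ltW//.
  by rewrite lerDl mulr_ge0// invr_ge0 ltW.
have rt0 : rho / t * s ^+ 2 <= rho0.
  rewrite mulrAC ler_pdivrMr// -ler_pdivrMl//; apply: le_trans smallt.
  by rewrite lerDr mulr_ge0// invr_ge0 ltW.
pose Dom := box x (Kd * s).
have Dx : Dom x by move=> l; rewrite subrr normr0; lra.
pose m := inf (u @` Dom).
have lbm : lbound (u @` Dom) (u x - omega).
  by move=> _ [y Dy <-]; have := osc _ _ Dx Dy; lra.
have mle y : Dom y -> m <= u y.
  by move=> Dy; apply: ge_inf; [exists (u x - omega)|exists y].
have leM y : Dom y -> u y <= m + omega.
  move=> Dy; suff : u y - omega <= m by lra.
  apply: lb_le_inf; first by exists (u x), x.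
  by move=> _ [z Dz <-]; have := osc _ _ Dy Dz; lra.
pose v y := u y + (- m); pose w y := - u y + (m + omega).
pose p : 'rV[R]_N := \row_l (x 0 l - s / 2).
have px : midpoint p s = x by apply/rowP => l; rewrite !mxE subrK.
have cubeD y : cube p s y -> forall z, box y Lambda z -> Dom z.
  move=> hy z hz l; have := cube_midpoint hy l; rewrite px !mxE => hl.
  have -> : z 0 l - x 0 l = (z 0 l - y 0 l) + (y 0 l - x 0 l) by ring.
  by apply: le_lt_trans (ler_normD _ _) _; have := hz l; lra.
have cubeDom y : cube p s y -> Dom y.
  move=> hy; apply: (cubeD y hy) => l; rewrite subrr normr0; lra.
have v0 y : Dom y -> 0 <= v y by move=> /mle; rewrite /v; lra.
have w0 y : Dom y -> 0 <= w y by move=> /leM; rewrite /w; lra.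
have sv y : Dom y -> supersol Lambda alpha beta rho v y.
  by move=> /su; exact: supersol_addr.
have sw y : Dom y -> supersol Lambda alpha beta rho w y.
  by move=> /sNu; exact: supersol_addr.
pose E : set (borel_rV R N) := [set y | m + omega / 2 <= u y].
have mE : measurable E.
  have := mu measurableT `[m + omega / 2, +oo[%classic (measurable_itv _).
  rewrite setTI; congr measurable; apply/seteqP.
  by split => y /=; rewrite /E/= in_itv/= andbT.
have tE : beta * c1 / 4 * (omega / 2) - rho >= t.
  by move: rt; rewrite /t /th; lra.
have t_inv : 0 < t^-1 by rewrite invr_gt0.
pose f v := fun y => t^-1 * v y.
have cells p' : cube p' h `<=` cube p s ->
    cell_ge (f v) 1 p' \/ cell_ge (f w) 1 p'.
  move=> hp'.
  have ge1 g : cell_ge g (beta * c1 / 4 * (omega / 2) - rho) p' -> cell_ge (f g) 1 p'.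
    move=> /cell_geP H; apply/cell_geP => y hy; rewrite /f.
    by rewrite mulrC ler_pdivlMr// mul1r; apply: le_trans tE (H y hy).
  have om2 : 0 <= omega / 2 by lra.
  have [] := @cell_dichotomy rho v w p' (omega / 2) E mE om2.
  - by move=> y /hp'/cubeDom; exact: sv.
  - by move=> y /hp'/cubeDom; exact: sw.
  - by move=> y z /hp'/cubeD H /H; exact: v0.
  - by move=> y z /hp'/cubeD H /H; exact: w0.
  - by move=> y; rewrite /E/= /v; lra.
  - by move=> y /negP; rewrite -ltNge /w; lra.
  - by move=> /ge1; left.
  - by move=> /ge1; right.
have Kgd y : box (midpoint p s) (Kg * s) y -> Dom y.
  by rewrite px; apply: DS; lra.
have concl g : (forall y, Dom y -> 0 <= g y) ->
    (forall y, Dom y -> supersol Lambda alpha beta rho g y) ->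
    (2 ^ (N * j) <= 2 * ncells h (cell_ge (f g) 1%R) j p)%N ->
    forall y, cube p s y -> c * omega <= g y.
  move=> g0 sg half y hy.
  have := G j p (f g) (t^-1 * rho); rewrite /= -/s => /(_ _ _ _ _ half y hy) H.
  have {}H : c0 <= f g y.
    apply: H.
    - by rewrite mulr_ge0// ltW.
    - by rewrite [t^-1 * _]mulrC.
    - by move=> z /Kgd/g0 H; rewrite mulr_ge0// ltW.
    - by move=> z /Kgd/sg H; exact: supersol_scale.
  move: H; rewrite /f mulrC ler_pdivlMr//; apply: le_trans.
  by rewrite /t mulrA ler_pM2r.
have sub y : box x (s / 2) y -> cube p s y.
  by move=> hy; apply: box_sub_cube; rewrite px.
have fin : (1 - c) * omega <= (1 - c) * omega + C * (rho * s ^+ 2).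
  rewrite lerDl mulr_ge0// ltW// addr_gt0// divr_gt0// invr_gt0//.
apply: le_trans fin.
have := ncells_compl h (cell_ge (f v) 1) j p.
(* By the dichotomy the cells lost for [v] are won for [w], so one of the two holds at least half of
   them. *)
have : (ncells h (predC (cell_ge (f v) 1%R)) j p <= ncells h (cell_ge (f w) 1%R) j p)%N.
  by apply: ncells_le => // p' /cells[H|//] /=; rewrite H.
have [hv|hv] := leqP (2 ^ (N * j)) (2 * ncells h (cell_ge (f v) 1%R) j p).
  move=> _ _; have := concl v v0 sv hv y2 (sub _ hy2); have := leM y1 D1.
  by rewrite /v; lra.
move=> H1 H2; have hw := leq_double_compl hv H1 H2.
have := concl w w0 sw hw y1 (sub _ hy1); have := mle y2 D2.
by rewrite /w; lra.
Qed.

End oscillation.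

(** * Iteration over scales and the estimate at unit scale *)

Section iteration.
Context (R : realType) (N : nat) (Lambda alpha beta : R).
Hypothesis N0 : (0 < N)%N.
Hypothesis Lambda_ge1 : 1 <= Lambda.
Hypothesis alpha_ge0 : 0 <= alpha.
Hypothesis beta_gt0 : 0 < beta.
Hypothesis ab1 : alpha + beta = 1.
Local Notation h := (2 * mesh R N).
Local Notation n := (N%:R : R).
Implicit Types (x y z : 'rV[R]_N) (u v : 'rV[R]_N -> R).

Lemma sideD (i j : nat) : side h (i + j) = 2 ^+ i * side h j.
Proof. by rewrite /side exprD -mulrA. Qed.

Lemma osc_iter : exists (lam C : R) (l : nat),
  [/\ 0 < lam < 1, 0 < C, (0 < l)%N &
  forall (L : nat) x u rho omega, 0 <= rho ->
    let T := side h (L * l) in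
    measurable_fun setT (u : borel_rV R N -> R) ->
    (forall y, box x (T / 2) y -> supersol Lambda alpha beta rho u y) ->
    (forall y, box x (T / 2) y ->
       supersol Lambda alpha beta rho (fun y => - u y) y) ->
    (forall y1 y2, box x (T / 2) y1 -> box x (T / 2) y2 -> u y1 - u y2 <= omega) ->
    forall i, (i <= L)%N -> forall y1 y2,
      box x (side h ((L - i) * l) / 2) y1 -> box x (side h ((L - i) * l) / 2) y2 ->
      u y1 - u y2 <= lam ^+ i * (omega + C * (rho * T ^+ 2))].
Proof.
have [c [C [Kd [c0 c1 C0 Kd0 H]]]] := osc_decay N0 Lambda_ge1 alpha_ge0 beta_gt0 ab1.
have h0 := h_gt0 R N0.
(* Half of the gain [c] is given up to pay for the right-hand side; the constant [2 * C / c] makes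
   it suffice. *)
pose lam := 1 - c / 2.
have lam2 : 1 / 2 <= lam by rewrite /lam; lra.
have lam1 : lam < 1 by rewrite /lam; lra.
have lam0 : 0 < lam by lra.
(* Descending [l] dyadic levels at once fits the box of half-side [Kd * s] into the box of the
   previous scale. *)
pose l := (Num.bound (2 * Kd)).+1.
have hl : 2 * Kd <= 2 ^+ l by apply/ltW/upper_nthrootP.
exists lam, (2 * C / c), l; split => //; first by rewrite lam0.
  by rewrite divr_gt0// mulr_gt0.
move=> L x u rho omega rho0 T mu su sNu osc.
have T0 : 0 < T by exact: side_gt0.
have om0 : 0 <= omega.
  have := osc x x; rewrite subrr; apply; move=> k; rewrite subrr normr0 divr_gt0//.
have rT : 0 <= rho * T ^+ 2 by rewrite mulr_ge0// sqr_ge0.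
set X := omega + _.
have X0 : 0 <= X by rewrite addr_ge0// mulr_ge0// divr_ge0 ?mulr_ge0 // ltW.
have sideLi i : (i <= L)%N -> side h ((L - i) * l) * 2 ^+ i <= T.
  move=> iL; rewrite /T -[in leRHS](subnKC iL) mulnDl sideD mulrC.
  by rewrite ler_pM2r ?side_gt0// ler_weXn2l ?ler1n// leq_pmulr.
elim=> [|i IH] iL y1 y2 hy1 hy2.
  rewrite expr0 mul1r; rewrite subn0 in hy1 hy2.
  by apply: le_trans (osc y1 y2 hy1 hy2) _; rewrite lerDl mulr_ge0// divr_ge0 ?mulr_ge0// ltW.
set s := side h ((L - i.+1) * l) in hy1 hy2.
have s0 : 0 < s by exact: side_gt0.
have sK : Kd * s <= side h ((L - i) * l) / 2.
  have -> : ((L - i) * l = l + (L - i.+1) * l)%N by rewrite -mulSn -subSn.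
  by rewrite sideD -/s; have := ler_wpM2r (ltW s0) hl; lra.
have ssub : side h ((L - i) * l) <= T.
  have := sideLi i (ltnW iL); apply: le_trans.
  by apply: ler_peMr; [rewrite ltW// side_gt0|rewrite exprn_ege1// ler1n].
have sub y : box x (Kd * s) y -> box x (T / 2) y.
  by move=> hy k; apply: lt_le_trans (hy k) _; lra.
have sub' y : box x (Kd * s) y -> box x (side h ((L - i) * l) / 2) y.
  by move=> hy k; apply: lt_le_trans (hy k) _.
have := H ((L - i.+1) * l)%N x u rho (lam ^+ i * X) rho0 mu
  (fun y hy => su y (sub y hy)) (fun y hy => sNu y (sub y hy))
  (fun y1 y2 hy1 hy2 => IH (ltnW iL) y1 y2 (sub' y1 hy1) (sub' y2 hy2)) y1 y2 hy1 hy2.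
rewrite -/s => /le_trans; apply.
have lami : 0 <= lam ^+ i by rewrite exprn_ge0// ltW.
(* The side shrinks at least by 2^-i while [lam] is at least 1/2, so the source term decays no
   slower than the oscillation. *)
have sT : s ^+ 2 <= lam ^+ i * T ^+ 2.
  have h1 := sideLi i.+1 iL; rewrite -/s in h1.
  have h2 : s * 2 ^+ i <= T.
    by apply: le_trans h1; rewrite ler_pM2l// ler_weXn2l// ler1n.
  have p1 : 1 <= 2 ^+ i :> R by rewrite exprn_ege1// ler1n.
  have h3 : 1 <= lam ^+ i * 2 ^+ i.
    by rewrite -exprMn exprn_ege1//; lra.
  have h4 : s ^+ 2 * 2 ^+ i <= T ^+ 2.
    apply: (@le_trans _ _ ((s * 2 ^+ i) ^+ 2)).
      rewrite [leRHS]exprMn; apply: ler_wpM2l; first exact: sqr_ge0.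
      by rewrite [leRHS]expr2; apply: ler_peMr => //.
    have h5 : 0 <= s * 2 ^+ i by apply: mulr_ge0; [exact: ltW|exact: exprn_ge0].
    by rewrite ler_pXn2r// nnegrE ltW.
  apply: (@le_trans _ _ (lam ^+ i * (s ^+ 2 * 2 ^+ i))).
    rewrite mulrCA -[leLHS]mulr1; apply: ler_wpM2l => //; exact: sqr_ge0.
  exact: ler_wpM2l.
have e1 : C * (rho * s ^+ 2) <= c / 2 * (lam ^+ i * X).
  apply: (@le_trans _ _ (lam ^+ i * (C * (rho * T ^+ 2)))).
    rewrite (_ : lam ^+ i * _ = C * (rho * (lam ^+ i * T ^+ 2))); last by ring.
    by apply: ler_wpM2l; [exact: ltW|exact: ler_wpM2l].
  rewrite [leRHS]mulrCA; apply: ler_wpM2l => //.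
  rewrite /X mulrDr (_ : c / 2 * (2 * C / c * (rho * T ^+ 2)) = C * (rho * T ^+ 2)); last first.
    by field; rewrite gt_eqF.
  by rewrite lerDr mulr_ge0// divr_ge0// ltW.
rewrite (exprS lam) -[leRHS]mulrA (_ : lam * (lam ^+ i * X) = (1 - c / 2) * (lam ^+ i * X)) //.
by lra.
Qed.


Lemma eball_box x y (r d : R) : 0 <= d -> enorm x + n * d < r ->
  box x d y -> eball 0 r y.
Proof.
move=> d0 hr hy.
have n1 : 1 <= n by rewrite ler1n.
have r0 : 0 < r by apply: le_lt_trans hr; rewrite addr_ge0 ?enorm_ge0// mulr_ge0.
apply/eball0_lt => //; rewrite -/(sq y) -(subrK x y) addrC sqD -enorm_sq.
have hc i : `|(y - x) 0 i| <= d by have /ltW := hy i; rewrite !mxE.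
have h1 := dot_coord_le x hc; have h2 := sumsq_le hc; rewrite -/(sq _) in h2.
rewrite ler_norml in h1; have /andP[_ h1'] := h1.
have x0 := enorm_ge0 x; have nd : 0 <= n * d by exact: mulr_ge0.
have : (enorm x + n * d) ^+ 2 < r ^+ 2.
  by rewrite ltr_pXn2r// nnegrE ?addr_ge0// ltW.
apply: le_lt_trans.
have : n * d ^+ 2 <= (n * d) ^+ 2.
  by rewrite exprMn ler_wpM2r ?sqr_ge0// expr2 ler_peMr// (le_trans ler01).
by lra.
Qed.

(** The witness [i] counts the scales between [r] and the distance of the points; keeping it defers
    logarithms to the choice of the exponent. The summand 1 stands for the cell size, at which the
    iteration stops. *)
Lemma holder_unit_scale : exists (lam C C1 b : R), [/\ 0 < lam < 1, 0 < C, 0 < C1, 1 < b &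
  forall (r rho S : R) v x z, n * h < r -> 0 <= rho -> 0 <= S ->
    measurable_fun setT (v : borel_rV R N -> R) ->
    (forall y, eball 0 r y -> supersol Lambda alpha beta rho v y) ->
    (forall y, eball 0 r y -> supersol Lambda alpha beta rho (fun y => - v y) y) ->
    (forall y, eball 0 r y -> `|v y| <= S) ->
    eball 0 (r / 2) x -> eball 0 (r / 2) z ->
    exists2 i : nat, `|v x - v z| <= lam ^+ i * (2 * S + C * (rho * r ^+ 2)) &
      r <= C1 * b ^+ i * (enorm (x - z) + 1)].
Proof.
have [lam [C [l [/andP[lam0 lam1] C0 l0 H]]]] := osc_iter.
have h0 := h_gt0 R N0.
have n1 : 1 <= n by rewrite ler1n.
pose b : R := 2 ^+ l.
have b1 : 1 < b by rewrite exprn_egt1 ?ltr1n// -lt0n.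
have b0 : 0 < b by lra.
have n0 : 0 < n by lra.
have sideb i : side h (i.+1 * l) = b * side h (i * l) by rewrite mulSn sideD.
have sidebi i : side h (i * l) = b ^+ i * h by rewrite /side mulnC exprM.
have h1 : h <= 1 by have := mesh_le R N0; lra.
exists lam, C, (2 * n * b ^+ 2), b; split => //; first by rewrite lam0.
  by rewrite !mulr_gt0// exprn_gt0.
move=> r rho S v x z rh rho0 S0 mv sv sNv vS hx hz.
have x2 : enorm x < r / 2 by move: hx; rewrite /eball/= subr0.
have z2 : enorm z < r / 2 by move: hz; rewrite /eball/= subr0.
have r0 : 0 < r by apply: lt_trans rh; exact: mulr_gt0.
(* The largest scale for which the box around [x], a point of the half ball, is sure to lie in the
   ball of radius [r]; level 0 qualifies since [n * h < r]. *)
have [L nL rL] : exists2 L, n * side h (L * l) < r & r <= n * side h (L.+1 * l).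
  have exm : exists m, r <= n * side h (m * l).
    exists (Num.bound (r / (n * h))).
    have nh0 : 0 < n * h by exact: mulr_gt0.
    rewrite sidebi mulrCA -ler_pdivrMr//.
    apply: ltW; apply: lt_le_trans (upper_nthrootP (leqnn _)) _.
    by rewrite lerXn2r ?nnegrE// ?(ltW b0)// /b -[leLHS]expr1 ler_weXn2l// ler1n.
  case: (ex_minnP exm) => -[|m] hm hmin.
    by move: hm; rewrite mul0n side0 leNgt rh.
  exists m => //; rewrite ltNge; apply/negP => /hmin; by rewrite ltnn.
set T := side h (L * l) in nL.
have T0 : 0 < T by exact: side_gt0.
have TD y : box x (T / 2) y -> eball 0 r y.
  by apply: eball_box; lra.
have xr : eball 0 r x by rewrite /eball/= subr0; lra.
have zr : eball 0 r z by rewrite /eball/= subr0; lra.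
have osc2 y1 y2 : eball 0 r y1 -> eball 0 r y2 -> v y1 - v y2 <= 2 * S.
  by move=> /vS + /vS; rewrite !ler_norml => /andP[? ?] /andP[? ?]; lra.
have iter := H L x v rho (2 * S) rho0 mv (fun y hy => sv y (TD y hy))
  (fun y hy => sNv y (TD y hy)) (fun y1 y2 hy1 hy2 => osc2 y1 y2 (TD y1 hy1) (TD y2 hy2)).
rewrite -/T in iter.
have Tr : rho * T ^+ 2 <= rho * r ^+ 2.
  have Tr : T <= r by have : T <= n * T := ler_peMl (ltW T0) n1; lra.
  by apply: ler_wpM2l => //; rewrite ler_pXn2r// nnegrE ltW.
have d0 := enorm_ge0 (x - z).
have farP i : ~ box x (side h (i * l) / 2) z -> side h (i * l) / 2 <= enorm (x - z).
  move=> nb; rewrite leNgt; apply/negP => lt; apply: nb => k.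
  apply: le_lt_trans lt; have := coord_le_enorm (x - z) k.
  by rewrite !mxE distrC.
have rLb : r <= n * b * T by move: rL; rewrite sideb mulrA.
have [near|far] := pselect (box x (T / 2) z); last first.
  exists 0%N.
    rewrite expr0 mul1r.
    have : 0 <= C * (rho * r ^+ 2).
      by apply: mulr_ge0; [exact: ltW|apply: mulr_ge0 => //; exact: sqr_ge0].
    have := osc2 x z xr zr; have := osc2 z x zr xr.
    by rewrite ler_norml => *; apply/andP; split; lra.
  have := farP L far; rewrite -/T => dT.
  rewrite expr0 mulr1; apply: le_trans rLb _.
  apply: (@le_trans _ _ (n * b * (2 * enorm (x - z)))).
    by apply: ler_wpM2l; [rewrite mulr_ge0// ltW|lra].
  rewrite (_ : 2 * n * b ^+ 2 * (enorm (x - z) + 1) =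
     n * b * (2 * enorm (x - z) * b + 2 * b)); last by ring.
  apply: ler_wpM2l; first by rewrite mulr_ge0// ltW.
  have : 2 * enorm (x - z) * 1 <= 2 * enorm (x - z) * b.
    by apply: ler_wpM2l; [lra|exact: ltW].
  by lra.
(* The last [i] for which [z] is still in the box around [x]. Leaving the next box bounds the
   distance from below; for [i = L] there is no next box and [h <= 1] takes its place. *)
pose P i := (i <= L)%N && `[< box x (side h ((L - i) * l) / 2) z >].
have P0 : P 0%N by rewrite /P leq0n subn0; apply/asboolP.
have [i /andP[iL /asboolP hi] imax] :
    exists2 i, P i & forall j, P j -> (j <= i)%N.
  have PL j : P j -> (j <= L)%N by move=> /andP[].
  by case: (ex_maxnP (ex_intro _ 0%N P0) PL) => i Pi hi; exists i.
exists i.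
  have bx : box x (side h ((L - i) * l) / 2) x.
    by move=> k; rewrite subrr normr0 divr_gt0// side_gt0.
  have := iter i iL x z bx hi; have := iter i iL z x hi bx.
  have : lam ^+ i * (2 * S + C * (rho * T ^+ 2)) <= lam ^+ i * (2 * S + C * (rho * r ^+ 2)).
    apply: ler_wpM2l; first by rewrite exprn_ge0// ltW.
    by rewrite lerD2l; apply: ler_wpM2l => //; exact: ltW.
  by rewrite ler_norml => *; apply/andP; split; lra.
have bi0 : 0 < b ^+ i by rewrite exprn_gt0.
apply: le_trans rLb _.
rewrite (_ : 2 * n * b ^+ 2 * b ^+ i * (enorm (x - z) + 1) =
  n * b * (b ^+ i * (b * (2 * (enorm (x - z) + 1))))); last by ring.
apply: ler_wpM2l; first by rewrite mulr_ge0// ltW.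
have TE : T = b ^+ i * side h ((L - i) * l).
  by rewrite /T !sidebi [RHS]mulrA -exprD subnKC.
rewrite TE; apply: ler_wpM2l; first exact: ltW.
have [iLt|] := ltnP i L; last first.
  move=> Li; rewrite (_ : (L - i = 0)%N); last by apply/eqP; rewrite subn_eq0.
  rewrite mul0n side0.
  have : 1 * (2 * (enorm (x - z) + 1)) <= b * (2 * (enorm (x - z) + 1)).
    by apply: ler_wpM2r; [lra|exact: ltW].
  by lra.
have Li : (L - i = (L - i.+1).+1)%N by rewrite subnSK.
have nb : ~ box x (side h ((L - i.+1) * l) / 2) z.
  move=> hb; have := imax i.+1; rewrite /P iLt ltnn => /(_ _)H'.
  by have : false by apply: H'; apply/asboolP.
have := farP _ nb; rewrite Li sideb => dT.
by apply: ler_wpM2l; [exact: ltW|lra].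
Qed.

End iteration.

(** * Return to the scale eps *)

Lemma powR_add_le (R : realType) (x y g : R) : 0 <= x -> 0 <= y -> 0 <= g ->
  (x + y) `^ g <= 2 `^ g * (x `^ g + y `^ g).
Proof.
move=> x0 y0 g0.
(* The sum is at most twice the larger term, whatever the size of the exponent. *)
have key (s t : R) : 0 <= s -> s <= t -> (s + t) `^ g <= 2 `^ g * (s `^ g + t `^ g).
  move=> s0 st; have t0 := le_trans s0 st.
  apply: (@le_trans _ _ ((2 * t) `^ g)).
    by apply: ge0_ler_powR; rewrite ?nnegrE//; [exact: addr_ge0|exact: mulr_ge0|lra].
  by rewrite powRM// ler_wpM2l ?powR_ge0// lerDr powR_ge0.
have [xy|yx] := leP x y; first exact: key.
by rewrite [x + y]addrC [_ `^ g + _]addrC; apply: key => //; exact: ltW.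
Qed.

Theorem theorem4p7 (R : realType) (N : nat) (Lambda alpha beta : R)
    (hN : (1 <= N)%N) (hLambda : 1 <= Lambda)
    (hbeta0 : 0 < beta) (hbeta1 : beta <= 1) (halpha : alpha = 1 - beta) :
  exists eps0 C gamma : R, [/\ 0 < eps0, 0 < C, 0 < gamma &
    forall (r rho eps : R) (u : 'rV[R]_N -> R),
      0 < r -> 0 <= rho -> 0 < eps -> eps < eps0 * r ->
      measurable_fun setT (u : borel_rV R N -> R) ->
      bounded_fun u ->
      (forall x, eball 0 r x -> - rho <= Lplus Lambda alpha beta eps u x) ->
      (forall x, eball 0 r x -> Lminus Lambda alpha beta eps u x <= rho) ->
      forall x z, eball 0 (r / 2) x -> eball 0 (r / 2) z ->
        `|u x - u z| <=
          C / r `^ gamma * (sup [set `|u y| | y in eball 0 r] + r ^+ 2 * rho)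
          * (enorm (x - z) `^ gamma + eps `^ gamma)].
Proof.
have alpha_ge0 : 0 <= alpha by rewrite halpha subr_ge0.
have ab1 : alpha + beta = 1 by rewrite halpha subrK.
have L0 : 0 < Lambda by exact: lt_le_trans hLambda.
have [lam [C [C1 [b [/andP[lam0 lam1] C0 C10 b1 H]]]]] :=
  holder_unit_scale hN hLambda alpha_ge0 hbeta0 ab1.
have n1 : 1 <= N%:R :> R by rewrite ler1n.
pose k : R := N%:R * (2 * mesh R N).
have k0 : 0 < k by rewrite mulr_gt0 ?h_gt0//; lra.
have lnb : 0 < ln b by exact: ln_gt0.
have ilam1 : 1 < lam^-1 by rewrite invf_gt1.
(* Chosen so that b^g = 1/lam: then lam^i is the power -g of b^i, and the lower bound for b^i turns
   into decay. *)
pose g := ln lam^-1 / ln b.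
have g0 : 0 < g by rewrite divr_gt0// ln_gt0.
have b0 : 0 < b by lra.
have bg : b `^ g = lam^-1.
  rewrite /powR gt_eqF// /g divfK ?gt_eqF// lnK// posrE; lra.
(* [k] equals 1/8, and [eps < k^-1 * r] says that the rescaled radius [r / eps] exceeds [k], as
   [holder_unit_scale] demands. *)
exists k^-1, ((2 * C1) `^ g * (2 + C)), g; split => //.
- by rewrite invr_gt0.
- by rewrite mulr_gt0 ?powR_gt0 ?mulr_gt0//; lra.
move=> r rho eps u r0 rho0 eps0 epsr mu bu hplus hminus x z hx hz.
have [M0 [_ hM]] := bu.
have uM y : `|u y| <= M0 + 1 by apply: hM => //; lra.
set S := sup _.
have uS y : eball 0 r y -> `|u y| <= S.
  move=> yr; apply: ub_le_sup; last by exists y.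
  by exists (M0 + 1) => _ [w _ <-].
have S0 : 0 <= S.
  by apply: le_trans (uS x _) => //; move: hx; rewrite /eball/= => hx; lra.
pose v (y : 'rV[R]_N) := u (eps *: y).
have mv : measurable_fun setT (v : borel_rV R N -> R).
  have := measurableT_comp mu (measurable_affine_rV (0 : 'rV[R]_N) eps).
  by congr measurable_fun; apply/funext => y /=; rewrite add0r.
have ball_scale t (y : 'rV[R]_N) : eball 0 (t / eps) y -> eball 0 t (eps *: y).
  by rewrite /eball/= !subr0 enormZ gtr0_norm// ltr_pdivlMr// mulrC.
have xE (y : 'rV[R]_N) : eps *: (eps^-1 *: y) = y.
  by rewrite scalerA divff ?gt_eqF// scale1r.
have ball_unscale (y : 'rV[R]_N) : eball 0 (r / 2) y -> eball 0 (r / eps / 2) (eps^-1 *: y).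
  rewrite /eball/= !subr0 enormZ gtr0_norm ?invr_gt0// => h.
  by rewrite mulrC [r / eps / 2]mulrAC ltr_pM2r// invr_gt0.
have kr : k < r / eps.
  by rewrite ltr_pdivlMr// -ltr_pdivlMl.
have rho'0 : 0 <= eps ^+ 2 * rho by rewrite mulr_ge0// sqr_ge0.
have sv y : eball 0 (r / eps) y -> supersol Lambda alpha beta (eps ^+ 2 * rho) v y.
  by move=> /(ball_scale r) /hminus; exact: (supersol_Lminus (M := M0 + 1)).
have sNv y : eball 0 (r / eps) y ->
    supersol Lambda alpha beta (eps ^+ 2 * rho) (fun y => - v y) y.
  by move=> /(ball_scale r) /hplus; exact: (supersol_Lplus (M := M0 + 1)).
have [i] := H (r / eps) (eps ^+ 2 * rho) S v (eps^-1 *: x) (eps^-1 *: z) kr rho'0 S0 mv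
  sv sNv (fun y hy => uS _ (ball_scale r y hy)) (ball_unscale x hx) (ball_unscale z hz).
rewrite /v !xE (_ : eps ^+ 2 * rho * (r / eps) ^+ 2 = r ^+ 2 * rho); last first.
  by field; rewrite gt_eqF.
rewrite -scalerBr enormZ (@gtr0_norm _ eps^-1) ?invr_gt0// => hu hr.
set d := enorm (x - z) in hr *.
have d0 : 0 <= d by exact: enorm_ge0.
have rr0 : 0 <= r ^+ 2 * rho by rewrite mulr_ge0// sqr_ge0.
have bi0 : 0 < b ^+ i by rewrite exprn_gt0.
have li0 : 0 < lam ^+ i by rewrite exprn_gt0.
have {}hr : r <= C1 * b ^+ i * (d + eps).
  move: hr; rewrite ler_pdivrMr// => /le_trans; apply.
  rewrite (_ : _ * eps = C1 * b ^+ i * (d + eps)) //.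
  by field; rewrite gt_eqF.
have big : (b ^+ i) `^ g = lam ^- i.
  rewrite -powR_mulrn ?(ltW b0)// -powRrM mulrC powRrM bg.
  by rewrite powR_mulrn ?invr_ge0 ?(ltW lam0)// exprVn.
have rg0 : 0 < r `^ g by rewrite powR_gt0.
have dg0 : 0 <= d `^ g + eps `^ g by rewrite addr_ge0// powR_ge0.
have h1 : lam ^+ i * r `^ g <= (2 * C1) `^ g * (d `^ g + eps `^ g).
  have C1b : 0 <= C1 * b ^+ i by rewrite mulr_ge0// ltW.
  have de : 0 <= d + eps by rewrite addr_ge0// ltW.
  have h2 : r `^ g <= (C1 * b ^+ i * (d + eps)) `^ g.
    by apply: ge0_ler_powR; rewrite ?nnegrE ?(ltW g0) ?(ltW r0)// mulr_ge0.
  rewrite powRM// powRM ?(ltW C10) ?(ltW bi0)// big in h2.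
  have h3 := powR_add_le d0 (ltW eps0) (ltW g0).
  rewrite powRM ?(ltW C10)// mulrC -ler_pdivlMr//; apply: le_trans h2 _.
  rewrite mulrAC ler_pM2r ?invr_gt0// [2 `^ g * _]mulrC -mulrA.
  by apply: ler_wpM2l => //; exact: powR_ge0.
apply: le_trans hu _.
apply: (@le_trans _ _ (lam ^+ i * ((2 + C) * (S + r ^+ 2 * rho)))).
  apply: ler_wpM2l; first exact: ltW.
  have : 0 <= C * S by rewrite mulr_ge0// ltW.
  by lra.
have X0 : 0 <= (2 + C) * (S + r ^+ 2 * rho) by rewrite mulr_ge0 ?addr_ge0// ltW.
have h4 : lam ^+ i <= (2 * C1) `^ g * (d `^ g + eps `^ g) / r `^ g.
  by rewrite ler_pdivlMr.
apply: le_trans (ler_wpM2r X0 h4) _.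
by rewrite le_eqVlt; apply/orP; left; apply/eqP; ring.
Qed.
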